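(* Let $\mathbf{B}$ be a mask of dimension $p$ whose associated vector subdivision scheme is $C^{\ell}$, for some integer $\ell\ge 0$. Let $k=\dim\mathcal{E}_{\mathbf{B}}$, let $\overline{R}$ be a canonical transformation for $\mathbf{B}$, and put $\overline{\mathbf{B}}=\overline{R}^{-1}\mathbf{B}\overline{R}$, $\overline{\mathbf{A}}=\mathcal{I}_k\overline{\mathbf{B}}$ and $\mathbf{A}=\overline{R}\,\overline{\mathbf{A}}\,\overline{R}^{-1}$. Then $\mathbf{A}$ is a (well-defined, finitely supported) mask and the vector subdivision scheme associated with $\mathbf{A}$ is $C^{\ell+1}$.
   Context: A mask of dimension $p$ is a finitely supported sequence $\mathbf{A}=\{A_i\in\mathbb{R}^{p\times p}: i\in\mathbb{Z}\}$; its symbol is $\mathbf{A}^*(z)=\sum_{i}A_iz^i$. The subdivision operator is $(S_{\mathbf{A}}c)_i=\sum_{j\in\mathbb{Z}}A_{i-2j}c_j$ for sequences $c$ in $\mathbb{R}^p$. The vector subdivision scheme (VSS) associated with $\mathbf{A}$ produces $c^n=S_{\mathbf{A}}^nc^0$. It is convergent (also called $C^0$) if for every bounded $c^0\in\ell^\infty(\mathbb{R}^p)$ there is $\Psi\in C(\mathbb{R},\mathbb{R}^p)$ with $\sup_{i\in\mathbb{Z}}\|c^n_i-\Psi(i/2^n)\|\to 0$ as $n\to\infty$, and $\Psi\ne 0$ for some $c^0$; it is $C^\ell$ if in addition $\Psi$ is $\ell$ times continuously differentiable for every initial data $c^0$. Put $A^0=\sum_iA_{2i}$, $A^1=\sum_iA_{2i+1}$,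 $M_{\mathbf{A}}=\frac12(A^0+A^1)$ and $\mathcal{E}_{\mathbf{A}}=\{v\in\mathbb{R}^p: A^0v=v\text{ and }A^1v=v\}$. For an invertible matrix $R$, $R^{-1}\mathbf{A}R$ denotes the mask $\{R^{-1}A_iR: i\in\mathbb{Z}\}$ (similarly $R\mathbf{A}R^{-1}$). Canonical transformation: for a mask $\mathbf{B}$ of a convergent VSS with $k=\dim\mathcal{E}_{\mathbf{B}}$ (necessarily $k\geq 1$), a real invertible matrix $\overline{R}=[v_1,\dots,v_k\,|\,Q]$, where $v_1,\dots,v_k$ is a basis of $\mathcal{E}_{\mathbf{B}}$ and the columns of $Q$ complete it to a basis of $\mathbb{R}^p$ and span the invariant space of $M_{\mathbf{B}}$ corresponding to the eigenvalues of $M_{\mathbf{B}}$ different from $1$. Smoothing operator: write masks in block form with $(1,1)$ block of size $k\times k$. For a mask $\mathbf{B}$ with $\mathbf{B}_{12}^*(1)=0$, $\mathcal{I}_k\mathbf{B}$ is the mask with symbol $$(\mathcal{I}_k\mathbf{B})^*(z)=\frac12\begin{pmatrix}(z^{-1}+1)\mathbf{B}_{11}^*(z) & \mathbf{B}_{12}^*(z)/(z^{-1}-1)\\ (z^{-2}-1)\mathbf{B}_{21}^*(z) & \mathbf{B}_{22}^*(z)\end{pmatrix}.$$ *)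

(* Defs.v *)
From HB Require Import structures.
From mathcomp Require Export all_boot all_order all_algebra.
From mathcomp Require Export all_classical all_reals all_analysis.
From mathcomp Require Export complex.

Set Implicit Arguments.
Unset Strict Implicit.
Unset Printing Implicit Defensive.

Export Order.TTheory GRing.Theory Num.Theory.
Export numFieldNormedType.Exports.
Local Open Scope classical_set_scope.
Local Open Scope ring_scope.

(* Coefficient families int -> 'M[R]_p are arbitrary; a mask is one of finite
   support. The sums \sum_(i \in [set: int]) below are the library's finitely
   supported sums. *)
Definition is_mask (R : realType) (p : nat) (A : int -> 'M[R]_p) : Prop :=
  finite_set [set i | A i != 0].

(* The symbol, evaluated at a complex number z. *)
Definition symbol (R : realType) (p : nat) (A : int -> 'M[R]_p) (z : R[i]) :
    'M[R[i]]_p :=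
  \sum_(i \in [set: int]) z ^ i *: map_mx (real_complex R) (A i).

Definition subdivision (R : realType) (p : nat) (A : int -> 'M[R]_p)
    (c : int -> 'cV[R]_p) : int -> 'cV[R]_p :=
  fun i => \sum_(j \in [set: int]) A (i - 2 * j) *m c j.

Definition bounded_data (R : realType) (p : nat) (c : int -> 'cV[R]_p) : Prop :=
  exists K : R, forall i, `|c i| <= K.

(* The supremum is taken in \bar R because the real-valued sup of an unbounded
   set is 0 by convention. `|_| on 'cV[R]_p is the max norm. *)
Definition vss_limit (R : realType) (p : nat) (A : int -> 'M[R]_p)
    (c : int -> 'cV[R]_p) (Psi : R -> 'cV[R]_p) : Prop :=
  continuous Psi /\
  (fun n : nat => ereal_sup
     [set (`|iter n (subdivision A) c i - Psi (i%:~R / 2 ^+ n)|)%:E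
        | i in [set: int]]) @ \oo --> 0%E.

Definition vss_convergent (R : realType) (p : nat) (A : int -> 'M[R]_p) : Prop :=
  (forall c, bounded_data c -> exists Psi, vss_limit A c Psi) /\
  (exists c Psi, [/\ bounded_data c, vss_limit A c Psi & exists x, Psi x != 0]).

Definition continuously_differentiable (R : realType) (V : normedModType R)
    (l : nat) (f : R -> V) : Prop :=
  (forall (j : nat) (x : R), (j < l)%N -> derivable (derive1n j f) x 1) /\
  continuous (derive1n l f).

(* A continuous limit is determined by its values at the dyadic rationals, so
   quantifying over all limits Psi is quantifying over the limit. *)
Definition vss_C (R : realType) (p : nat) (l : nat) (A : int -> 'M[R]_p) : Prop :=
  vss_convergent A /\
  forall c Psi, bounded_data c -> vss_limit A c Psi ->
    continuously_differentiable l Psi.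

Definition mask_even (R : realType) (p : nat) (A : int -> 'M[R]_p) : 'M[R]_p :=
  \sum_(i \in [set: int]) A (2 * i).

Definition mask_odd (R : realType) (p : nat) (A : int -> 'M[R]_p) : 'M[R]_p :=
  \sum_(i \in [set: int]) A (2 * i + 1).

Definition mask_mean (R : realType) (p : nat) (A : int -> 'M[R]_p) : 'M[R]_p :=
  2^-1 *: (mask_even A + mask_odd A).

Definition mask_eigenspace (R : realType) (p : nat) (A : int -> 'M[R]_p) :
    {vspace 'cV[R]_p} :=
  (passmx.leigenspace (linfun (mulmx (mask_even A))) 1 :&:
   passmx.leigenspace (linfun (mulmx (mask_odd A))) 1)%VS.

Lemma mask_eigenspaceP (R : realType) (p : nat) (A : int -> 'M[R]_p)
    (v : 'cV[R]_p) :
  v \in mask_eigenspace A <-> mask_even A *m v = v /\ mask_odd A *m v = v.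
Proof.
have leig1 (M : 'M[R]_p) :
    (v \in passmx.leigenspace (linfun (mulmx M)) 1) = (M *m v == v).
  by rewrite memv_ker !lfunE /= !lfunE /= scale1r lfunE subr_eq0.
rewrite memv_cap !leig1.
by split=> [/andP[/eqP ? /eqP ?]|[? ?]]; [split | apply/andP; split; apply/eqP].
Qed.

(* The real vectors lying, after complexification, in the sum of the generalized
   eigenspaces of M for its (complex) eigenvalues other than 1. The library's
   eigenspaces are row spaces, whence the transposes. *)
Definition invariant_space_neq1 (R : realType) (p : nat) (M : 'M[R]_p) :
    set 'cV[R]_p :=
  let MC : 'M[R[i]]_p := map_mx (real_complex R) M^T in
  [set v | (map_mx (real_complex R) v^T <=
     \big[addsmx/0]_(a \in [set a : R[i] | eigenvalue MC a /\ a != 1])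
       geigenspace MC a)%MS].

Definition canonical_transformation (R : realType) (k m : nat)
    (B : int -> 'M[R]_(k + m)) (T : 'M[R]_(k + m)) : Prop :=
  [/\ T \in unitmx,
      basis_of (mask_eigenspace B) [seq col j (lsubmx T) | j : 'I_k] &
      [set v | v \in <<[seq col j (rsubmx T) | j : 'I_m]>>%VS] =
        invariant_space_neq1 (mask_mean B)].

(* A is I_k B: equality of Laurent polynomials, expressed through their values.
   The point z = 1 is excluded because the (1,2) block divides by z^-1 - 1. *)
Definition is_smoothing (R : realType) (k m : nat)
    (B A : int -> 'M[R]_(k + m)) : Prop :=
  is_mask A /\
  forall z : R[i], z != 0 -> z != 1 ->
    symbol A z = 2^-1 *:
      block_mx ((z^-1 + 1) *: ulsubmx (symbol B z))
               ((z^-1 - 1)^-1 *: ursubmx (symbol B z))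
               ((z ^- 2 - 1) *: dlsubmx (symbol B z))
               (drsubmx (symbol B z)).

(* Main.v *)
Require Import Defs.
From mathcomp Require Import zify ring lra.
Set Implicit Arguments.
Unset Strict Implicit.
Local Open Scope classical_set_scope.
Local Open Scope ring_scope.

(** Let [P] be the projection onto the eigenspace of [B] that is diag(I, 0) in
    the basis [T], and let [D c = P (c(. + 1) - c) + (1 - P) c]: a difference on
    the first [k] coordinates, the identity on the others.  On symbols, [D] is
    multiplication by diag(z^-1 - 1, 1), so the block formula for the smoothed
    mask [A] says exactly that [D S_A = 1/2 S_B D]
    ([smoothing_mask_difference], [partial_difference_subdivision]).  Hence
    [D (S_A^n c) = 2^-n S_B^n (D c)]: the differences of [a^n = S_A^n c],
    multiplied by [2^n], form a convergent scheme, and the limit of [S_A] should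
    be a primitive of the limit [Psi] of [S_B] for the data [D c].

    This is made rigorous without any spectral radius.  Limits of [S_B] take
    their values in the eigenspace, that is in the image of [P]
    ([vss_limit_mask_part]), so that [2^n (a^n(. + 1) - a^n)] as a whole, and not
    only its [P]-part, tends uniformly to [Psi].  The iterates [S_B^n (D c)] are
    bounded uniformly in [n] ([iter_subdivision_uniformly_bounded]).  As the even
    part of [A] fixes the image of [P], [a^(n+1)(2i) - a^n(i)] is then
    [O(2^-n)] uniformly in [i].  Therefore [a^n(floor(2^n x))] is a Cauchy
    sequence for each real [x]; its limit [Phi x] satisfies
    [|a^n(i) - Phi(i / 2^n)| = O(2^-n)] uniformly in [i], because the floor is
    exact at dyadic points.  Summing differences gives [Phi' = Psi]
    ([primitive_is_derive]), so [Phi] has one more derivative than [Psi].  The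
    limit of [S_A] is not always zero since [S_A] preserves the constant sequences
    with value in the image of [P], which is not zero because it contains the
    nonzero values of limits of [S_B].  All this is [smoothing_vss_C].

    What remains is linear algebra.  The columns of the right part of [T] span a
    subspace stable under [mask_mean B], whence the vanishing of the (1,2) block of
    the symbol at [1]; this makes the partial sums of the (1,2) blocks of the
    coefficients finitely supported, and they are the coefficients of the quotient
    by [z^-1 - 1].  Uniqueness of the smoothed mask holds because a Laurent
    polynomial with infinitely many zeros is zero ([symbol_inj]). *)

(** * Dyadic error estimates *)

Lemma pow2_gt0 (R : realType) n : 0 < 2 ^+ n :> R.
Proof. by rewrite exprn_gt0. Qed.

Lemma dyadic_small (R : realType) (C e : R) :
  0 < e -> exists n0, forall n, (n0 <= n)%N -> C / 2 ^+ n <= e.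
Proof.
move=> e0; exists (Num.bound `|C / e|) => n n0n.
rewrite ler_pdivrMr ?pow2_gt0// mulrC -ler_pdivrMr//.
apply: (@le_trans _ _ (Num.bound `|C / e|)%:R).
  by apply/ltW; rewrite (le_lt_trans (ler_norm _))// archi_boundP.
by rewrite -natrX ler_nat (leq_trans n0n)// ltnW// ltn_expl.
Qed.

Lemma le_of_dyadic_error (R : realType) (x y C : R) :
  (exists n0, forall n, (n0 <= n)%N -> x <= y + C / 2 ^+ n) -> x <= y.
Proof.
move=> [n0 h]; apply/ler_addgt0Pr => e /(dyadic_small C)[n1 h1].
apply: le_trans (h (maxn n0 n1) (leq_maxl _ _)) _.
by rewrite lerD2l h1// leq_maxr.
Qed.

(** The increments sum to a geometric series; the distance to the limit is
    controlled at every rank, which is what gives uniform estimates later. *)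
Lemma geometric_limit (R : realType) p (u : nat -> 'cV[R]_p) (C : R) :
  (forall n, `|u n.+1 - u n| <= C / 2 ^+ n) ->
  exists l, forall n, `|u n - l| <= 2 * C / 2 ^+ n.
Proof.
move=> uC.
have C0 : 0 <= C by have := uC 0%N; rewrite expr0 divr1; apply: le_trans.
have cau n m : `|u (n + m)%N - u n| <= 2 * C / 2 ^+ n - 2 * C / 2 ^+ (n + m).
  elim: m => [|m IH]; first by rewrite addn0 !subrr normr0.
  have := uC (n + m)%N; rewrite addnS exprS => h.
  have -> : u (n + m).+1 - u n = (u (n + m).+1 - u (n + m)%N) + (u (n + m)%N - u n).
    by rewrite addrA subrK.
  apply: le_trans (ler_normD _ _) _; apply: le_trans (lerD h IH) _.
  rewrite le_eqVlt; apply/orP; left; apply/eqP.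
  move: (2 ^+ (n + m)) (pow2_gt0 R (n + m)) (2 * C / 2 ^+ n) => x x0 y.
  by field; rewrite gt_eqF.
have cau' n m : (n <= m)%N -> `|u m - u n| <= 2 * C / 2 ^+ n.
  move=> nm; rewrite -(subnKC nm); apply: le_trans (cau _ _) _.
  by rewrite lerBlDr lerDl divr_ge0 ?mulr_ge0// ltW// pow2_gt0.
have /cvg_ex[l ul] : cvg (u n @[n --> \oo]).
  apply/cauchy_cvgP/cauchy_exP => e e0.
  have e20 : 0 < e / 2 by rewrite divr_gt0.
  have [n0 h] := dyadic_small (2 * C) e20.
  exists (u n0); exists n0 => // m /= nm.
  rewrite -ball_normE /ball_ /= distrC (le_lt_trans (cau' _ _ nm))//.
  by rewrite (le_lt_trans (h _ (leqnn _)))// ltr_pdivrMr// ltr_pMr// ltr1n.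
exists l => n; apply/ler_addgt0Pr => e e0.
have /cvgrPdist_le/(_ e e0)[n1 _ h] := ul.
pose m := maxn n n1.
have -> : u n - l = - (l - u m) - (u m - u n) by rewrite !opprB [RHS]addrC addrA subrK.
rewrite (le_trans (ler_normB _ _))// normrN addrC lerD//.
  by rewrite cau'// leq_maxl.
by apply: h => /=; rewrite leq_maxr.
Qed.

Lemma telescope_le (R : realType) p (a : int -> 'cV[R]_p) v (E : R) (i : int) k :
  (forall j, (j < k)%N -> `|a (i + j%:Z + 1) - a (i + j%:Z) - v| <= E) ->
  `|a (i + k%:Z) - a i - k%:R *: v| <= k%:R * E.
Proof.
elim: k => [|k IH] h; first by rewrite addr0 subrr scale0r subrr normr0 mul0r.
have -> : i + k.+1%:Z = i + k%:Z + 1 by lia.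
have -> : a (i + k%:Z + 1) - a i - k.+1%:R *: v =
    (a (i + k%:Z + 1) - a (i + k%:Z) - v) + (a (i + k%:Z) - a i - k%:R *: v).
  by apply/matrixP => r s; rewrite !mxE -natr1; ring.
rewrite -natr1 mulrDl mul1r addrC.
apply: le_trans (ler_normD _ _) _; rewrite lerD//; last exact: h.
by apply: IH => j jk; apply: h; rewrite ltnW.
Qed.

Lemma floor_dyadic (R : realType) (i : int) n :
  Num.floor (2 ^+ n * (i%:~R / 2 ^+ n) : R) = i.
Proof.
by rewrite mulrC divfK ?gt_eqF ?pow2_gt0// intrKfloor.
Qed.

(** * Primitives from dyadic difference quotients *)

Lemma floor_double (R : realType) (x : R) :
  Num.floor (2 * x) = 2 * Num.floor x \/ Num.floor (2 * x) = 2 * Num.floor x + 1.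
Proof.
have /andP[h1 h2] := floor_itv x; rewrite intrD in h2.
have [h|h] := lerP (2 * x) (2 * (Num.floor x)%:~R + 1); last first.
  right; apply: floor_def; rewrite !intrD intrM !mulr1z; apply/andP; split; lra.
move: h; rewrite le_eqVlt => /predU1P[->|h].
  by right; rewrite -(intrM R 2) -(intrD R _ 1) intrKfloor.
by left; apply: floor_def; rewrite !intrD intrM !mulr1z; apply/andP; split; lra.
Qed.

Section Primitive.
Variables (R : realType) (p : nat) (a g : nat -> int -> 'cV[R]_p).
Variables (Psi : R -> 'cV[R]_p) (C K : R).
Hypothesis aC : forall n i, `|a n.+1 (2 * i) - a n i| <= C / 2 ^+ n.
Hypothesis ag : forall n i, a n (i + 1) - a n i = 2 ^- n *: g n i.
Hypothesis gK : forall n i, `|g n i| <= K.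

(** Passing from rank [n] to [n + 1] at [x] is a doubling of the index, possibly
    followed by one step to the right. *)
Lemma floor_sequence_cvg (x : R) :
  exists l, forall n, `|a n (Num.floor (2 ^+ n * x)) - l| <= 2 * (C + K) / 2 ^+ n.
Proof.
apply: geometric_limit => n; rewrite exprS -mulrA [leRHS]mulrDl.
have K0 : 0 <= K by apply: le_trans (gK n 0).
have P0 := pow2_gt0 R n.
have [->|->] := floor_double (2 ^+ n * x).
  by rewrite (le_trans (aC _ _))// lerDl divr_ge0// ltW.
set f := Num.floor _.
have -> : a n.+1 (2 * f + 1) - a n f =
   (a n.+1 (2 * f) - a n f) + (a n.+1 (2 * f + 1) - a n.+1 (2 * f)).
  by rewrite [RHS]addrC addrA subrK.
rewrite (le_trans (ler_normD _ _))// lerD// ag normrZ.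
rewrite gtr0_norm ?invr_gt0 ?pow2_gt0// mulrC.
apply: ler_pM => //.
by rewrite lef_pV2 ?posrE ?pow2_gt0// exprS ler_pMl// ler1n.
Qed.

Variable Phi : R -> 'cV[R]_p.
Hypothesis aPhi :
  forall x n, `|a n (Num.floor (2 ^+ n * x)) - Phi x| <= 2 * (C + K) / 2 ^+ n.
Hypothesis gPsi : forall e, 0 < e ->
  exists n0, forall n, (n0 <= n)%N -> forall i, `|g n i - Psi (i%:~R / 2 ^+ n)| <= e.

(** The difference [a n beta - a n alpha], with [alpha] and [beta] the floors of
    [2^n s] and [2^n t], is a Riemann sum of [g n] of mesh [2^-n], and [g n] is
    close to [v] on all of its nodes.  The margin [d] is there because
    [alpha / 2^n] may lie slightly to the left of [s]; the factor 2 absorbs the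
    distance from [g n] to [Psi]. *)
Lemma primitive_increment (s t : R) v (E d : R) : s <= t -> 0 < E -> 0 < d ->
  (forall r, s - d <= r <= t -> `|Psi r - v| <= E) ->
  `|Phi t - Phi s - (t - s) *: v| <= 2 * E * (t - s).
Proof.
move=> st E0 d0 PsiE; apply: (@le_of_dyadic_error _ _ _ (4 * (C + K) + `|v| + 2 * E)).
have [n1 h1] := gPsi E0; have [n2 h2] := dyadic_small 1 d0.
exists (maxn n1 n2) => n; rewrite geq_max => /andP[/h1{}h1 /h2{}h2].
have P0 := pow2_gt0 R n.
set q : R := 2 ^+ n in h1 h2 P0 *.
have /andP[s1 s2] := floor_itv (q * s); have /andP[t1 t2] := floor_itv (q * t).
have ast := aPhi s n; have att := aPhi t n.
rewrite -/q in ast att; rewrite !intrD in s2 t2.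
have ab : Num.floor (q * s) <= Num.floor (q * t).
  by rewrite floor_ge_int (le_trans s1)// ler_pM2l.
set al := Num.floor (q * s) in ab s1 s2 ast; set be := Num.floor (q * t) in ab t1 t2 att.
pose k := `|be - al|%N.
have bk : be = al + k%:Z by rewrite /k; lia.
have kE : k%:R = be%:~R - al%:~R :> R by rewrite bk intrD addrC addKr.
have step j : (j < k)%N ->
    `|a n (al + j%:Z + 1) - a n (al + j%:Z) - q^-1 *: v| <= 2 * E / q.
  move=> jk; rewrite ag -/q -scalerBr normrZ gtr0_norm ?invr_gt0// mulrC.
  rewrite ler_pM2r ?invr_gt0//.
  have -> : g n (al + j%:Z) - v = (g n (al + j%:Z) - Psi ((al + j%:Z)%:~R / q)) +
      (Psi ((al + j%:Z)%:~R / q) - v) by rewrite addrA subrK.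
  rewrite (le_trans (ler_normD _ _))// mulr_natl mulr2n lerD// PsiE//.
  have jk' : j%:R <= k%:R :> R by rewrite ler_nat ltnW.
  have j0 : 0 <= j%:R :> R by [].
  rewrite intrD ler_pdivlMr// ler_pdivrMr//.
  move: h2; rewrite ler_pdivrMr// => h2.
  change ((j%:Z)%:~R : R) with (j%:R : R); move: jk'; rewrite kE => jk'.
  by apply/andP; split; lra.
have := telescope_le step; rewrite -bk => tel.
have -> : Phi t - Phi s - (t - s) *: v =
    (a n be - a n al - k%:R *: (q^-1 *: v)) - (a n be - Phi t) + (a n al - Phi s)
    + (k%:R / q - (t - s)) *: v.
  by apply/matrixP => r c; rewrite !mxE; ring.
have kts : `|k%:R / q - (t - s)| <= q^-1.
  have q0 : q != 0 by rewrite gt_eqF.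
  rewrite -[t - s](mulfK q0) -mulrBl normrM (@gtr0_norm _ q^-1) ?invr_gt0//.
  rewrite ler_piMl ?invr_ge0 ?(ltW P0)// kE ler_norml; apply/andP; split; lra.
have kts' : k%:R / q <= (t - s) + q^-1.
  by rewrite -lerBlDl (le_trans _ kts)// ler_norm.
apply: (@le_trans _ _ (k%:R * (2 * E / q) + 2 * (C + K) / q + 2 * (C + K) / q
   + q^-1 * `|v|)).
  apply: le_trans (ler_normD _ _) _; rewrite lerD//; last first.
    by rewrite normrZ ler_wpM2r.
  apply: le_trans (ler_normD _ _) _; rewrite lerD//.
  by apply: le_trans (ler_normB _ _) _; rewrite lerD.
have -> : k%:R * (2 * E / q) = 2 * E * (k%:R / q) by ring.
have : 2 * E * (k%:R / q) <= 2 * E * (t - s + q^-1) by rewrite ler_pM2l// mulr_gt0.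
move: (k%:R / q) (q^-1) => kq iq; set vn := `|v|; lra.
Qed.

Hypothesis Psic : continuous Psi.

Lemma primitive_is_derive (x : R) : is_derive x 1 Phi (Psi x).
Proof.
suff h : (h^-1 *: (Phi (h *: (1 : R) + x) - Phi x)) @[h --> 0^'] --> Psi x.
  by apply: DeriveDef; [exact: cvgP h | exact: cvg_lim h].
apply/cvgrPdist_le => e e0.
have e20 : 0 < e / 2 by rewrite divr_gt0.
have /cvgrPdist_le/(_ _ e20) := @Psic x.
rewrite -nbhs_ballE => -[d /= d0 hd].
have d20 : 0 < d / 2 by rewrite divr_gt0.
have PsiE r : `|r - x| < d -> `|Psi r - Psi x| <= e / 2.
  by move=> rx; rewrite distrC; apply: hd; rewrite -ball_normE /ball_ /= distrC.
have key s t : s <= t -> `|s - x| < d / 2 -> `|t - x| < d / 2 ->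
    `|Phi t - Phi s - (t - s) *: Psi x| <= e * (t - s).
  move=> st sx tx.
  have -> : e = 2 * (e / 2) by rewrite mulrC divfK.
  apply: (@primitive_increment _ _ _ _ (d / 2)) => // r /andP[r1 r2].
  by apply: PsiE; move: sx tx; rewrite !ltr_norml => /andP[? ?] /andP[? ?]; lra.
exists (d / 2) => //= h; rewrite /ball_ /= sub0r normrN => hd2 hn0.
rewrite scaler1.
have -> : Psi x - h^-1 *: (Phi (h + x) - Phi x) =
    - h^-1 *: (Phi (h + x) - Phi x - ((h + x) - x) *: Psi x).
  by rewrite addrK scaleNr [in RHS]scalerBr scalerA mulVf// scale1r opprB.
rewrite normrZ normrN normfV mulrC ler_pdivrMr ?normr_gt0//.
have [h0|h0] := leP 0 h.
  have -> : `|h| = h + x - x by rewrite addrK ger0_norm.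
  by apply: key; rewrite ?subrr ?normr0 ?addrK// lerDr.
have -> : `|h| = x - (h + x) by rewrite ltr0_norm //; ring.
rewrite -normrN.
have -> : - (Phi (h + x) - Phi x - (h + x - x) *: Psi x) =
   Phi x - Phi (h + x) - (x - (h + x)) *: Psi x.
  by apply/matrixP => r c; rewrite !mxE; ring.
by apply: key; rewrite ?subrr ?normr0 ?addrK// gerDr ltW.
Qed.
End Primitive.

(** * Masks and subdivision operators *)

(** Masks vanish outside such a symmetric range, so that the finitely supported
    sums over the integers become ordinary iterated sums. *)
Definition int_range (N : nat) : seq int :=
  [seq k%:Z - N%:Z | k <- iota 0 (N + N + 1)].

Lemma mem_int_range N i : (i \in int_range N) = (`|i| <= N)%N.
Proof.
apply/mapP/idP => [[k]|iN]; first by rewrite mem_iota => ? ->; lia.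
by exists (absz (i + N%:Z)); rewrite ?mem_iota; lia.
Qed.

Lemma uniq_int_range N : uniq (int_range N).
Proof. by rewrite map_inj_uniq ?iota_uniq// => a b /addIr[]. Qed.

Lemma fsum_int_range (V : nmodType) (F : int -> V) N :
  (forall i, (N < `|i|)%N -> F i = 0) ->
  \sum_(i \in [set: int]) F i = \sum_(i <- int_range N) F i.
Proof.
move=> F0; rewrite (@fsbigE _ _ _ _ _ (int_range N)) ?uniq_int_range//.
  by apply: eq_bigl => i; rewrite in_setT.
by move=> i _; rewrite mem_int_range -ltnNge => /F0.
Qed.

Definition mask_within (R : realType) p (A : int -> 'M[R]_p) (N : nat) : Prop :=
  forall i, (N < `|i|)%N -> A i = 0.

Lemma is_maskP (R : realType) p (A : int -> 'M[R]_p) :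
  is_mask A <-> exists N, mask_within A N.
Proof.
split=> [/finite_seqP[s sE]|[N AN]]; last first.
  apply/finite_seqP; exists [seq i <- int_range N | A i != 0].
  apply/seteqP; split=> [i Ai|i] /=; last by rewrite mem_filter => /andP[].
  rewrite mem_filter Ai mem_int_range leqNgt.
  by apply: contra Ai => /AN ->.
exists (\max_(i <- s) `|i|)%N => i; rewrite ltnNge; apply: contraNeq => Ai.
have : [set` s] i by rewrite -sE.
by move=> /(@leq_bigmax_seq _ s xpredT absz); apply.
Qed.

Section Subdivision.
Variables (R : realType) (p : nat) (A : int -> 'M[R]_p) (N : nat).
Hypothesis AN : mask_within A N.

(** The whole sum over [j], over a range that may be chosen common to several
    masks and several indices [i]. *)
Lemma subdivision_range c i M : (N + `|i| <= M)%N ->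
  subdivision A c i = \sum_(j <- int_range M) A (i - 2 * j) *m c j.
Proof. by move=> NM; apply: fsum_int_range => j jM; rewrite AN ?mul0mx//; lia. Qed.

(** Here the range does not depend on [i], which makes bounds uniform in [i]. *)
Lemma subdivision_parity c i e : 0 <= e <= 1 ->
  subdivision A c (2 * i + e) = \sum_(j <- int_range N) A (2 * j + e) *m c (i - j).
Proof.
move=> e01; rewrite /subdivision.
rewrite (@reindex_fsbigT _ _ _ int int (fun j : int => i - j)); last first.
  by exists (fun j : int => i - j) => j; lia.
rewrite (@fsum_int_range _ _ N) => [|j jN].
  by apply: eq_bigr => j _; congr (A _ *m _); lia.
by rewrite AN ?mul0mx//; lia.
Qed.

Definition mask_part e := \sum_(j \in [set: int]) A (2 * j + e).

Lemma mask_partE e : 0 <= e <= 1 ->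
  mask_part e = \sum_(j <- int_range N) A (2 * j + e).
Proof. by move=> e01; apply: fsum_int_range => j jN; apply: AN; lia. Qed.

Lemma subdivision_sum (I : Type) (s : seq I) (f : I -> int -> 'cV[R]_p) :
  subdivision A (fun i => \sum_(x <- s) f x i) =
  fun i => \sum_(x <- s) subdivision A (f x) i.
Proof.
apply/funext => i; rewrite (subdivision_range _ (leqnn _)).
under [RHS]eq_bigr do rewrite (subdivision_range _ (leqnn _)).
by rewrite exchange_big /=; apply: eq_bigr => j _; rewrite mulmx_sumr.
Qed.

Lemma subdivisionZ x (c : int -> 'cV[R]_p) :
  subdivision A (fun i => x *: c i) = fun i => x *: subdivision A c i.
Proof.
apply/funext => i; rewrite !(subdivision_range _ (leqnn _)) scaler_sumr.
by apply: eq_bigr => j _; rewrite scalemxAr.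
Qed.

Lemma subdivisionD (c d : int -> 'cV[R]_p) :
  subdivision A (fun i => c i + d i) = fun i => subdivision A c i + subdivision A d i.
Proof.
apply/funext => i; rewrite !(subdivision_range _ (leqnn _)) -big_split /=.
by apply: eq_bigr => j _; rewrite mulmxDr.
Qed.

Lemma subdivision_shift t (c : int -> 'cV[R]_p) :
  subdivision A (fun i => c (i + t)) = fun i => subdivision A c (i + 2 * t).
Proof.
apply/funext => i; rewrite /subdivision.
rewrite [RHS](@reindex_fsbigT _ _ _ int int (fun j : int => j + t)); last first.
  by exists (fun j : int => j - t) => j; lia.
by apply: eq_fsbigr => j _; congr (A _ *m _); lia.
Qed.

Lemma iter_subdivision_sum n (I : Type) (s : seq I) (f : I -> int -> 'cV[R]_p) :
  iter n (subdivision A) (fun i => \sum_(x <- s) f x i) =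
  fun i => \sum_(x <- s) iter n (subdivision A) (f x) i.
Proof. by elim: n => //= n ->; rewrite subdivision_sum. Qed.

Lemma iter_subdivisionD n (c d : int -> 'cV[R]_p) :
  iter n (subdivision A) (fun i => c i + d i) =
  fun i => iter n (subdivision A) c i + iter n (subdivision A) d i.
Proof. by elim: n => //= n ->; rewrite subdivisionD. Qed.

Lemma iter_subdivisionZ n x (c : int -> 'cV[R]_p) :
  iter n (subdivision A) (fun i => x *: c i) =
  fun i => x *: iter n (subdivision A) c i.
Proof. by elim: n => //= n ->; rewrite subdivisionZ. Qed.

Lemma iter_subdivision_shift n t (c : int -> 'cV[R]_p) :
  iter n (subdivision A) (fun i => c (i + t)) =
  fun i => iter n (subdivision A) c (i + 2 ^+ n * t).
Proof.
elim: n t => [|n IH] t; first by apply/funext => i /=; rewrite expr0 mul1r.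
rewrite /= IH subdivision_shift; apply/funext => i; congr (subdivision _ _ _).
by rewrite exprS mulrA.
Qed.

(** A coefficient at index [j] of the data influences, at rank [n], only the
    indices at distance at most [N (2^n - 1)] from [2^n j]: the sum of
    [N 2^r] over [r < n]. *)
Lemma iter_subdivision_local n (c : int -> 'cV[R]_p) i :
  (forall j, `|i - 2 ^+ n * j| <= N%:Z * (2 ^+ n - 1) -> c j = 0) ->
  iter n (subdivision A) c i = 0.
Proof.
elim: n c i => [|n IH] c i h.
  by apply: h; rewrite expr0 subrr mulr0 mul1r subrr.
rewrite iterSr; apply: IH => j hj.
rewrite (subdivision_range _ (leqnn _)) big1_seq// => l _.
have [jl|jl] := leqP (absz (j - 2 * l)%R) N; last by rewrite AN// mul0mx.
rewrite h ?mulmx0//.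
have -> : i - 2 ^+ n.+1 * l = (i - 2 ^+ n * j) + 2 ^+ n * (j - 2 * l).
  by rewrite exprS; move: (2 ^+ n) => q; lia.
have -> : N%:Z * (2 ^+ n.+1 - 1) = N%:Z * (2 ^+ n - 1) + 2 ^+ n * N%:Z.
  by rewrite exprS; move: (2 ^+ n) => q; lia.
rewrite (le_trans (ler_normD _ _))// lerD// normrM.
by rewrite ger0_norm ?exprn_ge0// ler_pM2l ?exprn_gt0.
Qed.

End Subdivision.

(** * Norm estimates *)

Lemma coord_norm_le (R : realType) p (v : 'cV[R]_p) i : `|v i 0| <= `|v|.
Proof.
rewrite [leRHS]/Num.norm /= mx_normrE.
by apply/bigmax_geP; right => /=; exists (i, 0).
Qed.

Lemma norm_le_coord (R : realType) p (v : 'cV[R]_p) C :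
  0 <= C -> (forall i, `|v i 0| <= C) -> `|v| <= C.
Proof.
move=> C0 h; rewrite [leLHS]/Num.norm /= mx_normrE.
by apply/bigmax_leP; split=> // -[i j] _ /=; rewrite ord1.
Qed.

Lemma mulmx_norm_le (R : realType) p (M : 'M[R]_p) :
  exists2 C, 0 <= C & forall v : 'cV_p, `|M *m v| <= C * `|v|.
Proof.
exists (\sum_i \sum_j `|M i j|).
  by apply: sumr_ge0 => i _; apply: sumr_ge0.
move=> v; apply: norm_le_coord => [|i].
  by rewrite mulr_ge0//; apply: sumr_ge0 => i _; apply: sumr_ge0.
rewrite mxE (le_trans (ler_norm_sum _ _ _))//.
rewrite [X in _ <= X * _](bigD1 i)//= mulrDl ler_wpDr//.
  by rewrite mulr_ge0//; apply: sumr_ge0 => ? _; apply: sumr_ge0.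
rewrite mulr_suml ler_sum// => j _.
by rewrite normrM ler_wpM2l// coord_norm_le.
Qed.

Lemma mask_norm_bounds (R : realType) p (A : int -> 'M[R]_p) :
  {f : int -> R & forall i, 0 <= f i /\ forall v : 'cV_p, `|A i *m v| <= f i * `|v|}.
Proof.
apply: (choice (P := fun i x => 0 <= x /\ forall v : 'cV_p, `|A i *m v| <= x * `|v|)) => i.
by have [C C0 CP] := mulmx_norm_le (A i); exists C.
Qed.

Lemma subdivision_norm_le (R : realType) p (A : int -> 'M[R]_p) N :
  mask_within A N -> exists2 C, 0 <= C & forall (c : int -> 'cV[R]_p) K,
    (forall i, `|c i| <= K) -> forall i, `|subdivision A c i| <= C * K.
Proof.
move=> AN.
have [f fP] := mask_norm_bounds A.
pose g e := \sum_(j <- int_range N) f (2 * j + e).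
have g0 e : 0 <= g e by apply: sumr_ge0 => j _; have [] := fP (2 * j + e).
exists (g 0 + g 1) => [|c K cK i]; first by rewrite addr_ge0.
have K0 : 0 <= K by rewrite (le_trans _ (cK 0)).
have par e : 0 <= e <= 1 -> `|subdivision A c (2 * (i %/ 2)%Z + e)| <= g e * K.
  move=> e01; rewrite (subdivision_parity AN)// (le_trans (ler_norm_sum _ _ _))//.
  rewrite mulr_suml ler_sum// => j _; have [f0 fA] := fP (2 * j + e).
  by rewrite (le_trans (fA _))// ler_wpM2l.
have [iE|iE] : i = 2 * (i %/ 2)%Z + 0 \/ i = 2 * (i %/ 2)%Z + 1 by lia.
  by rewrite iE (le_trans (par 0 _))// ler_wpM2r// lerDl.
by rewrite iE (le_trans (par 1 _))// ler_wpM2r// lerDr.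
Qed.

(** The supremum in the extended reals, unfolded into a uniform estimate. *)
Lemma vss_limitP (R : realType) p (A : int -> 'M[R]_p) c (Psi : R -> 'cV[R]_p) :
  vss_limit A c Psi <-> continuous Psi /\ forall e, 0 < e ->
    exists n0, forall n, (n0 <= n)%N -> forall i,
      `|iter n (subdivision A) c i - Psi (i%:~R / 2 ^+ n)| <= e.
Proof.
pose S n := ereal_sup [set (`|iter n (subdivision A) c i - Psi (i%:~R / 2 ^+ n)|)%:E
        | i in [set: int]].
have leS n i : ((`|iter n (subdivision A) c i - Psi (i%:~R / 2 ^+ n)|)%:E <= S n)%E.
  by apply: ereal_sup_ubound; exists i.
have Sle n e : (forall i, `|iter n (subdivision A) c i - Psi (i%:~R / 2 ^+ n)| <= e) ->
    (S n <= e%:E)%E.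
  by move=> h; apply: ge_ereal_sup => _ [i _ <-]; rewrite lee_fin.
have S0 n : (0 <= S n)%E by rewrite (le_trans _ (leS n 0)).
have Sfin n e : (S n <= e%:E)%E -> S n \is a fin_num.
  by move=> Sn; rewrite ge0_fin_numE// (le_lt_trans Sn)// ltry.
split=> -[cPsi]; rewrite -/S => h; split=> //.
  move=> e e0; have /fine_cvgP[[n1 _ fin] /cvgrPdist_le/(_ e e0)[n2 _ hn]] := h.
  exists (maxn n1 n2) => n; rewrite geq_max => /andP[/fin nf /hn nh] i.
  move: nh; rewrite /= sub0r normrN => nh.
  rewrite -lee_fin (le_trans (leS n i))// -(fineK nf) lee_fin.
  by rewrite (le_trans _ nh)// ler_norm.
apply/fine_cvgP; split.
  by have [n0 hn] := h 1 ltr01; exists n0 => // n /= /hn/Sle/Sfin.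
apply/cvgrPdist_le => e e0; have [n0 hn] := h e e0; exists n0 => // n /= /hn/Sle Sn.
change (`|0 - fine (S n)| <= e).
by rewrite sub0r normrN ger0_norm ?fine_ge0// -lee_fin fineK//; exact: Sfin Sn.
Qed.

(** * Limits of subdivision schemes *)

Section Limits.
Variables (R : realType) (p : nat) (A : int -> 'M[R]_p) (N : nat).
Hypothesis AN : mask_within A N.
Implicit Types (c : int -> 'cV[R]_p) (Psi : R -> 'cV[R]_p).

Lemma iter_subdivision_bounded n c : bounded_data c ->
  bounded_data (iter n (subdivision A) c).
Proof.
move=> bc; elim: n => //= n [K h].
by have [C _ hC] := subdivision_norm_le AN; exists (C * K); exact: hC.
Qed.

(** Uniform convergence and continuity of the limit combine into one estimate at
    all indices staying at a bounded distance from [2^n x]. *)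
Lemma vss_limit_near c Psi x D e : vss_limit A c Psi -> 0 < e ->
  exists n0, forall n, (n0 <= n)%N -> forall i : int,
    `|i%:~R - 2 ^+ n * x| <= D -> `|iter n (subdivision A) c i - Psi x| <= e.
Proof.
move=> /vss_limitP[cPsi h] e0; have e20 : 0 < e / 2 by rewrite divr_gt0.
have [n1 h1] := h _ e20.
have /cvgrPdist_le/(_ _ e20) := cPsi x.
rewrite -nbhs_ballE => -[d /= d0 hd].
have d20 : 0 < d / 2 by rewrite divr_gt0.
have [n2 h2] := dyadic_small D d20.
exists (maxn n1 n2) => n; rewrite geq_max => /andP[/h1{}h1 /h2{}h2] i iD.
have -> : iter n (subdivision A) c i - Psi x =
    (iter n (subdivision A) c i - Psi (i%:~R / 2 ^+ n)) + (Psi (i%:~R / 2 ^+ n) - Psi x).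
  by rewrite addrA subrK.
rewrite (le_trans (ler_normD _ _))// [leRHS]splitr lerD// distrC; apply: hd.
rewrite -ball_normE /ball_ /= distrC.
have P0 := pow2_gt0 R n.
have -> : i%:~R / 2 ^+ n - x = (i%:~R - 2 ^+ n * x) / 2 ^+ n.
  by rewrite mulrBl [2 ^+ n * x]mulrC mulfK// gt_eqF.
rewrite normrM normfV (gtr0_norm P0).
apply: (@le_lt_trans _ _ (D / 2 ^+ n)); first by rewrite ler_wpM2r ?invr_ge0// ltW.
by apply: le_lt_trans h2 _; rewrite ltr_pdivrMr// ltr_pMr// ltr1n.
Qed.

Lemma norm_floor_dyadic_le (x : R) n : `|(Num.floor (2 ^+ n * x))%:~R - 2 ^+ n * x| <= 1.
Proof.
have /andP[h1 h2] := floor_itv (2 ^+ n * x); rewrite intrD in h2.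
by rewrite ler_norml; apply/andP; split; lra.
Qed.

Lemma vss_limit_unique c Psi1 Psi2 :
  vss_limit A c Psi1 -> vss_limit A c Psi2 -> Psi1 = Psi2.
Proof.
move=> h1 h2; apply/funext => x; apply/eqP; rewrite -subr_eq0 -normr_le0.
apply/ler_addgt0Pr => e e0; rewrite add0r; have e20 : 0 < e / 2 by rewrite divr_gt0.
have [n1 {}h1] := vss_limit_near x 1 h1 e20; have [n2 {}h2] := vss_limit_near x 1 h2 e20.
pose n := maxn n1 n2; have := norm_floor_dyadic_le x n; set u := Num.floor _ => hu.
have -> : Psi1 x - Psi2 x = (iter n (subdivision A) c u - Psi2 x) -
    (iter n (subdivision A) c u - Psi1 x).
  by rewrite opprB [RHS]addrC addrA subrK.
rewrite (le_trans (ler_normB _ _))// [leRHS]splitr lerD//.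
  by apply: h2 => //; rewrite leq_maxr.
by apply: h1 => //; rewrite leq_maxl.
Qed.

(** Let [i / 2^n] tend to [x] in
    [c^(n+1)(2i + e) = sum_j A(2j + e) c^n(i - j)]: every [c^n(i - j)] and the
    left-hand side tend to [Psi x]. *)
Lemma vss_limit_mask_part c Psi x e : vss_limit A c Psi -> 0 <= e <= 1 ->
  mask_part A e *m Psi x = Psi x.
Proof.
move=> lim e01; apply/eqP; rewrite -subr_eq0 -normr_le0.
have [f fP] := mask_norm_bounds A.
pose F := \sum_(j <- int_range N) f (2 * j + e).
have F0 : 0 <= F by apply: sumr_ge0 => j _; have [] := fP (2 * j + e).
apply/ler_addgt0Pr => d d0; rewrite add0r.
have F1 : 0 < F + 1 by rewrite ltr_wpDl.
have d'0 : 0 < d / (F + 1) by rewrite divr_gt0.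
(* [N + 3] bounds both [N + 1], for the indices [u - j] with [|j| <= N], and [3],
   for the index [2 u + e]; here [|u - 2^n x| <= 1]. *)
have [n0 h0] := vss_limit_near x (N%:R + 3) lim d'0.
have := norm_floor_dyadic_le x n0; set u := Num.floor _ => hu.
have far (i : int) : `|i - u| <= N%:Z -> `|i%:~R - 2 ^+ n0 * x| <= N%:R + 3.
  move=> iu; have -> : i%:~R - 2 ^+ n0 * x = (i - u)%:~R + (u%:~R - 2 ^+ n0 * x).
    by rewrite intrB addrA subrK.
  rewrite (le_trans (ler_normD _ _))// lerD//; last by rewrite (le_trans hu)// ler1n.
  by rewrite -intr_norm -[N%:R]/(N%:Z%:~R) ler_int.
have far' : `|(2 * u + e)%:~R - 2 ^+ n0.+1 * x| <= N%:R + 3.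
  have -> : (2 * u + e)%:~R - 2 ^+ n0.+1 * x = 2 * (u%:~R - 2 ^+ n0 * x) + e%:~R.
    by rewrite intrD intrM exprS; ring.
  rewrite (le_trans (ler_normD _ _))// normrM (@ger0_norm _ 2)//.
  have e1 : `|e%:~R| <= 1 :> R.
    have /andP[e0 e1] := e01.
    by rewrite ger0_norm ?ler0z// -[1]/(1%:~R) ler_int.
  have N0 : 0 <= N%:R :> R by [].
  by move: e1 hu N0; move: `|_| `|_| => ? ?; lra.
(* As [mask_part A e] is the sum of the [A (2 j + e)], the terms in [Psi x] of the
   sum on the right add up to the left-hand side. *)
have -> : mask_part A e *m Psi x - Psi x =
   (iter n0.+1 (subdivision A) c (2 * u + e) - Psi x) -
   \sum_(j <- int_range N) A (2 * j + e) *m (iter n0 (subdivision A) c (u - j) - Psi x).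
  rewrite [iter _ _ _]/= (subdivision_parity AN)// (mask_partE AN)//.
  under [X in _ - _ - X]eq_bigr do rewrite mulmxBr.
  by rewrite sumrB mulmx_suml opprB [RHS]addrC addrA subrK.
have -> : d = d / (F + 1) + F * (d / (F + 1)).
  by rewrite -[X in X + _]mul1r -mulrDl [1 + F]addrC mulrC divfK// gt_eqF.
rewrite (le_trans (ler_normB _ _))// lerD//; first exact: h0.
rewrite (le_trans (ler_norm_sum _ _ _))// mulr_suml big_seq [leRHS]big_seq.
rewrite ler_sum// => j; rewrite mem_int_range => jN.
have [f0 fA] := fP (2 * j + e); rewrite (le_trans (fA _))// ler_wpM2l//.
by apply: h0 => //; apply: far; lia.
Qed.

Definition delta_data (r : 'I_p) : int -> 'cV[R]_p :=
  fun i => (i == 0)%:R *: delta_mx r 0.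

Hypothesis conv : forall c, bounded_data c -> exists Psi, vss_limit A c Psi.

Lemma delta_data_bounded r : bounded_data (delta_data r).
Proof.
exists `|delta_mx r 0 : 'cV[R]_p| => i; rewrite normrZ ler_piMl//.
by case: (i == 0); rewrite ?normr1 ?normr0.
Qed.

(** By locality the iterates live on the indices [i] with [|i| <= N 2^n], that is
    on [|i / 2^n| <= N], where the continuous limit is bounded; the finitely many
    ranks before the limit is within distance 1 are bounded one by one. *)
Lemma iter_delta_uniformly_bounded r :
  exists K, forall n i, `|iter n (subdivision A) (delta_data r) i| <= K.
Proof.
have [Psi /vss_limitP[cPsi lim]] := conv (delta_data_bounded r).
have [n0 h0] := lim 1 ltr01.
have [M hM] : exists M, forall x, - N%:R <= x <= N%:R -> `|Psi x| <= M.
  have N0 : - N%:R <= N%:R :> R by rewrite ge0_cp.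
  have := @EVT_max R (fun x => `|Psi x|) _ _ N0.
  case=> [|x _ hx].
    by apply: continuous_subspaceT => x; apply: cvg_norm; exact: cPsi.
  by exists `|Psi x| => y yN; apply: hx; rewrite in_itv.
have [f fP] : {f : nat -> R & forall n i, `|iter n (subdivision A) (delta_data r) i| <= f n}.
  apply: (choice (P := fun n x => forall i, `|iter n (subdivision A) (delta_data r) i| <= x)) => n.
  exact: iter_subdivision_bounded (delta_data_bounded r).
have M0 : 0 <= M by rewrite (le_trans _ (hM 0 _))// oppr_le0 !ler0n.
have f0 n : 0 <= f n by rewrite (le_trans _ (fP n 0)).
exists (1 + M + \sum_(n < n0) f n) => n i.
have [nn0|nn0] := ltnP n n0.
  rewrite (le_trans (fP n i))// (bigD1 (Ordinal nn0))//= addrCA lerDl.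
  by rewrite addr_ge0 ?addr_ge0// sumr_ge0.
suff h : `|iter n (subdivision A) (delta_data r) i| <= 1 + M.
  by rewrite (le_trans h)// lerDl sumr_ge0.
have [iN|iN] := lerP `|i| (N%:Z * 2 ^+ n); last first.
  rewrite (iter_subdivision_local AN) ?normr0 ?addr_ge0// => j hj.
  rewrite /delta_data; have [j0|] := eqVneq j 0; last by rewrite scale0r.
  move: hj; rewrite j0 mulr0 subr0 mulrBr mulr1 => hj.
  by move: iN hj; move: (_ * _) => q; lia.
have -> : iter n (subdivision A) (delta_data r) i =
   (iter n (subdivision A) (delta_data r) i - Psi (i%:~R / 2 ^+ n)) + Psi (i%:~R / 2 ^+ n).
  by rewrite subrK.
rewrite (le_trans (ler_normD _ _))// lerD ?h0// hM// -ler_norml.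
rewrite normrM normfV (gtr0_norm (pow2_gt0 R n)) ler_pdivrMr ?pow2_gt0//.
rewrite -intr_norm; have : (`|i|%:~R : R) <= (N%:Z * 2 ^+ n)%:~R by rewrite ler_int.
by rewrite intrM rmorphXn.
Qed.

(** By locality only the values of [c] on a window of [2N + 1] integers matter for
    a given index at a given rank.  On that window [c] is a combination of
    translates of the delta data, with a number of terms independent of the index
    and of the rank. *)
Lemma iter_subdivision_uniformly_bounded c : bounded_data c ->
  exists K, forall n i, `|iter n (subdivision A) c i| <= K.
Proof.
move=> [C cC]; have C0 : 0 <= C by rewrite (le_trans _ (cC 0)).
have [K KP] : {K : 'I_p -> R & forall r n i, `|iter n (subdivision A) (delta_data r) i| <= K r}.
  apply: (choice
    (P := fun r x => forall n i, `|iter n (subdivision A) (delta_data r) i| <= x)) => r.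
  exact: iter_delta_uniformly_bounded.
exists (\sum_(t <- int_range N) \sum_r C * K r) => n i.
pose q := (i %/ 2 ^+ n)%Z.
pose c1 (j : int) := \sum_(t <- int_range N) \sum_r c (q + t) r 0 *: delta_data r (j + - (q + t)).
(* [c1] is [c] on the window of center [q = floor (i / 2^n)] and radius [N], and
   zero elsewhere. *)
have c1E j : (`|j - q| <= N)%N -> c1 j = c j.
  rewrite -mem_int_range => jq; rewrite /c1 (bigD1_seq (j - q))//= ?uniq_int_range//.
  rewrite [X in _ + X]big1 ?addr0 => [|t tj].
    rewrite [RHS]matrix_sum_delta; apply: eq_bigr => r _.
    rewrite big_ord1 /delta_data; have -> : q + (j - q) = j by lia.
    by rewrite subrr eqxx scale1r.
  apply: big1 => r _; rewrite /delta_data.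
  have -> : (j - (q + t) == 0) = false by apply/eqP; move/eqP: tj; lia.
  by rewrite scale0r scaler0.
have -> : iter n (subdivision A) c i = iter n (subdivision A) c1 i.
  have -> : c = fun j => c1 j + (c j - c1 j) by apply/funext => j; rewrite addrC subrK.
  rewrite (iter_subdivisionD AN) [X in _ + X](iter_subdivision_local AN) ?addr0//.
  move=> j hj; rewrite c1E ?subrr//.
  have := divz_eq i (2 ^+ n); rewrite -/q.
  have := modz_ge0 i (_ : 2 ^+ n != 0 :> int); have := ltz_pmod i (_ : 0 < 2 ^+ n :> int).
  move: hj; have : 0 < 2 ^+ n :> int by rewrite exprn_gt0.
  move: (2 ^+ n) => Q Q0 hj /(_ Q0) m1 /(_ (lt0r_neq0 Q0)) m0 iE.
  move: (i %% Q)%Z m0 m1 iE => m m0 m1 iE.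
  rewrite -ltnS ltnNge; apply/negP => jq.
  (* An index [j] outside of the window is too far from [i / 2^n] to matter: with
     [i = q Q + m], [0 <= m < Q] and [|k| > N], one has [|m - Q k| > N (Q - 1)]. *)
  have [k kE] : exists k : int, j = q + k by exists (j - q); lia.
  move: hj jq; rewrite iE kE.
  have -> : q * Q + m - Q * (q + k) = m - Q * k by lia.
  have -> : q + k - q = k by lia.
  have : N%:Z * (Q - 1) = N%:Z * Q - N%:Z by lia.
  move: (N%:Z * (Q - 1)) => S -> hj jq.
  have [k1|k1] : k <= - N%:Z - 1 \/ N%:Z + 1 <= k by lia.
    have : 0 <= Q * (- N%:Z - 1 - k) by apply: mulr_ge0; lia.
    by move: hj; lia.
  have : 0 <= Q * (k - (N%:Z + 1)) by apply: mulr_ge0; lia.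
  by move: hj; lia.
rewrite /c1 (iter_subdivision_sum AN) (le_trans (ler_norm_sum _ _ _))//.
apply: ler_sum => t _; rewrite (iter_subdivision_sum AN).
rewrite (le_trans (ler_norm_sum _ _ _))//; apply: ler_sum => r _.
rewrite (iter_subdivisionZ AN) normrZ.
rewrite (iter_subdivision_shift A n (- (q + t)) (delta_data r)).
by rewrite ler_pM// (le_trans (coord_norm_le _ _)).
Qed.

End Limits.

(** * Gaining one derivative *)

Lemma mask_part0 (R : realType) p (A : int -> 'M[R]_p) : mask_part A 0 = mask_even A.
Proof. by apply: eq_fsbigr => i _; rewrite addr0. Qed.

Lemma mask_part1 (R : realType) p (A : int -> 'M[R]_p) : mask_part A 1 = mask_odd A.
Proof. by []. Qed.

Lemma lipschitz_int (R : realType) p (a : int -> 'cV[R]_p) E :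
  (forall i, `|a (i + 1) - a i| <= E) ->
  forall i j, `|a (i - j) - a i| <= `|j|%:~R * E.
Proof.
move=> aE.
have up i (k : nat) : `|a (i + k%:Z) - a i| <= k%:R * E.
  have := @telescope_le R p a 0 E i k; rewrite scaler0 subr0; apply=> j _.
  by rewrite subr0.
move=> i j; have [j0|j0] := leP 0 j.
  have := up (i - j) `|j|%N; rewrite distrC.
  have -> : i - j + `|j|%N%:Z = i by lia.
  by rewrite -[`|j|%N%:R]/(`|j|%N%:Z%:~R) abszE.
have := up i `|j|%N; have -> : i + `|j|%N%:Z = i - j by lia.
by rewrite -[`|j|%N%:R]/(`|j|%N%:Z%:~R) abszE.
Qed.

(** The operator with symbol diag(z^-1 - 1, 1) in a basis where [P] is
    diag(I, 0). *)
Definition partial_difference (R : realType) p (P : 'M[R]_p) (c : int -> 'cV[R]_p) :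
    int -> 'cV[R]_p :=
  fun i => P *m (c (i + 1) - c i) + (1%:M - P) *m c i.

Section Smoothing.
Variables (R : realType) (p : nat) (A B : int -> 'M[R]_p) (P : 'M[R]_p) (N : nat).
Hypotheses (AN : mask_within A N) (BN : mask_within B N).
Hypothesis PP : P *m P = P.
Hypothesis AB : forall i, P *m (A (i + 1) - A i) + (1%:M - P) *m A i =
  2^-1 *: ((B (i + 2) - B i) *m P + B i *m (1%:M - P)).
Hypothesis AP : forall e, 0 <= e <= 1 -> mask_part A e *m P = P.
Hypothesis BP : forall v : 'cV_p, mask_even B *m v = v -> mask_odd B *m v = v -> P *m v = v.
Hypothesis Bconv : forall c, bounded_data c -> exists Psi, vss_limit B c Psi.

(** The hypothesis on [A] and [B] is this commutation relation, coefficient by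
    coefficient. *)
Lemma partial_difference_subdivision c :
  partial_difference P (subdivision A c) =
  fun i => 2^-1 *: subdivision B (partial_difference P c) i.
Proof.
apply/funext => i.
have -> : partial_difference P c =
    fun j => (fun j => P *m c j) (j + 1) + (1%:M - P - P) *m c j.
  apply/funext => j; rewrite /partial_difference mulmxBr 2!mulmxBl.
  by rewrite -addrA [- _ + _]addrC mulmxBl mul1mx.
rewrite (subdivisionD BN) (subdivision_shift B 1 (fun j => P *m c j)) /partial_difference.
pose M := (N + `|i| + 2)%N.
rewrite !(@subdivision_range _ _ _ N _ _ _ M) //; try by rewrite /M; lia.
rewrite -sumrB !mulmx_sumr -!big_split scaler_sumr /=.
apply: eq_bigr => j _; have H := congr1 (fun X => X *m c j) (AB (i - 2 * j)).
have e1 : i - 2 * j + 1 = i + 1 - 2 * j by lia.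
have e2 : i - 2 * j + 2 = i + 2 * 1 - 2 * j by lia.
rewrite e1 e2 -scalemxAl mulmxDl in H.
have -> : P *m (A (i + 1 - 2 * j) *m c j - A (i - 2 * j) *m c j) =
    P *m (A (i + 1 - 2 * j) - A (i - 2 * j)) *m c j by rewrite -mulmxBl mulmxA.
rewrite [(1%:M - P) *m (_ *m _)]mulmxA H; congr (_ *: _).
rewrite !mulmxA -mulmxDl mulmxBl [_ *m (1%:M - P - P)]mulmxBr.
by rewrite -addrA [- _ + _]addrC.
Qed.

Lemma partial_difference_iter n c i :
  partial_difference P (iter n (subdivision A) c) i =
  2 ^- n *: iter n (subdivision B) (partial_difference P c) i.
Proof.
elim: n i => [|n IH] i; first by rewrite expr0 invr1 scale1r.
rewrite /= partial_difference_subdivision.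
have -> : partial_difference P (iter n (subdivision A) c) =
  fun i => 2 ^- n *: iter n (subdivision B) (partial_difference P c) i by exact/funext.
by rewrite (subdivisionZ BN) scalerA exprS invfM.
Qed.

Lemma partial_difference_bounded c :
  bounded_data c -> bounded_data (partial_difference P c).
Proof.
move=> [K cK]; have [C1 C10 h1] := mulmx_norm_le P.
have [C2 C20 h2] := mulmx_norm_le (1%:M - P).
exists (C1 * (K + K) + C2 * K) => i; rewrite (le_trans (ler_normD _ _))// lerD//.
  by rewrite (le_trans (h1 _))// ler_wpM2l// (le_trans (ler_normB _ _))// lerD.
by rewrite (le_trans (h2 _))// ler_wpM2l.
Qed.

(** With [Q = 1 - P] and [b^n = S_B^n (D c)], the commutation relation gives
    [a^n(i + 1) - a^n(i) = 2^-n g^n(i)] where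
    [g^n(i) = P b^n(i) + Q (b^n(i + 1) - b^n(i))].  The second term tends to
    zero because [Q Psi = 0], so [g^n] tends to [P Psi = Psi]. *)
Lemma smoothing_limit c : bounded_data c -> exists Phi Psi,
  [/\ vss_limit A c Phi, vss_limit B (partial_difference P c) Psi &
      forall x : R, is_derive x 1 Phi (Psi x)].
Proof.
move=> bc; have bd := partial_difference_bounded bc.
have [Psi limPsi] := Bconv bd.
have [K bK] := iter_subdivision_uniformly_bounded BN Bconv bd.
have K0 : 0 <= K by rewrite (le_trans _ (bK 0%N 0)).
have PPsi x : P *m Psi x = Psi x.
  by apply: BP; rewrite -?mask_part0 -?mask_part1 (vss_limit_mask_part BN _ limPsi).
pose Q := 1%:M - P.
have QPsi x : Q *m Psi x = 0 by rewrite mulmxBl mul1mx PPsi subrr.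
have QP : Q *m P = 0 by rewrite mulmxBl mul1mx PP subrr.
have PQ : P *m Q = 0 by rewrite mulmxBr mulmx1 PP subrr.
have QQ : Q *m Q = Q by rewrite {2}/Q mulmxBr mulmx1 QP subr0.
pose a n := iter n (subdivision A) c.
(* [2^n] times the difference of [a n] is [g n] below: the [P]-part of the
   difference is read off the commutation relation, and so is the [Q]-part of [a n]
   itself, of which the difference is then taken. *)
pose b n := iter n (subdivision B) (partial_difference P c).
have {}bK n i : `|b n i| <= K := bK n i.
pose g n i := P *m b n i + Q *m (b n (i + 1) - b n i).
have Dab n i : P *m (a n (i + 1) - a n i) + Q *m a n i = 2 ^- n *: b n i.
  exact: partial_difference_iter.
have Pa n i : P *m (a n (i + 1) - a n i) = 2 ^- n *: (P *m b n i).
  have := congr1 (mulmx P) (Dab n i).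
  by rewrite mulmxDr !mulmxA PP PQ mul0mx addr0 -scalemxAr.
have Qa n i : Q *m a n i = 2 ^- n *: (Q *m b n i).
  have := congr1 (mulmx Q) (Dab n i).
  by rewrite mulmxDr !mulmxA QP QQ mul0mx add0r -scalemxAr.
have ag n i : a n (i + 1) - a n i = 2 ^- n *: g n i.
  rewrite scalerDr -Pa [Q *m _]mulmxBr scalerBr -!Qa -mulmxBr -mulmxDl.
  by rewrite /Q [P + _]addrC subrK mul1mx.
have [C1 C10 h1] := mulmx_norm_le P; have [C2 C20 h2] := mulmx_norm_le Q.
have gK n i : `|g n i| <= C1 * K + C2 * (K + K).
  rewrite (le_trans (ler_normD _ _))// lerD//.
    by rewrite (le_trans (h1 _))// ler_wpM2l.
  by rewrite (le_trans (h2 _))// ler_wpM2l// (le_trans (ler_normB _ _))// lerD.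
set G := C1 * K + C2 * (K + K) in gK.
have G0 : 0 <= G by rewrite (le_trans _ (gK 0%N 0)).
have gPsi e : 0 < e -> exists n0, forall n, (n0 <= n)%N ->
    forall i, `|g n i - Psi (i%:~R / 2 ^+ n)| <= e.
  move=> e0; have C0 : 0 < C1 + C2 + C2 + 1 by rewrite ltr_wpDl// !addr_ge0.
  have [_ /(_ _ (divr_gt0 e0 C0))[n0 h0]] := (vss_limitP _ _ _).1 limPsi.
  exists n0 => n /h0{}h0 i.
  set y := e / _ in h0.
  have y0 : 0 <= y by rewrite (le_trans _ (h0 0)).
  have -> : g n i - Psi (i%:~R / 2 ^+ n) = P *m (b n i - Psi (i%:~R / 2 ^+ n)) +
     (Q *m (b n (i + 1) - Psi ((i + 1)%:~R / 2 ^+ n)) - Q *m (b n i - Psi (i%:~R / 2 ^+ n))).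
    rewrite /g !mulmxBr !QPsi PPsi !subr0.
    by rewrite addrAC.
  apply: (@le_trans _ _ (C1 * y + (C2 * y + C2 * y))).
    rewrite (le_trans (ler_normD _ _))// lerD//.
      by rewrite (le_trans (h1 _))// ler_wpM2l// h0.
    rewrite (le_trans (ler_normB _ _))// lerD//.
      by rewrite (le_trans (h2 _))// ler_wpM2l// h0.
    by rewrite (le_trans (h2 _))// ler_wpM2l// h0.
  have -> : e = (C1 + C2 + C2 + 1) * y by rewrite /y mulrC divfK// gt_eqF.
  by rewrite !mulrDl mul1r addrA lerDl.
have [f fP] := mask_norm_bounds A.
pose F := \sum_(j <- int_range N) f (2 * j).
(* The two parts of [a (n+1) (2 i) - a n i]: replacing each [a n (i - j)] by [a n i]
   costs [O(2^-n)] since neighbours differ by [O(2^-n)], and the even part of [A]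
   moves [a n i] only through its [Q]-part, itself [O(2^-n)]. *)
have [C3 C30 h3] := mulmx_norm_le ((mask_part A 0 - 1%:M) *m Q).
have aC n i : `|a n.+1 (2 * i) - a n i| <= (F * (N%:R * G) + C3 * K) / 2 ^+ n.
  have P0 := pow2_gt0 R n.
  have -> : a n.+1 (2 * i) - a n i =
      \sum_(j <- int_range N) A (2 * j) *m (a n (i - j) - a n i) +
      2 ^- n *: (((mask_part A 0 - 1%:M) *m Q) *m b n i).
    rewrite -mulmxA scalemxAr -Qa mulmxA.
    have -> : (mask_part A 0 - 1%:M) *m Q = mask_part A 0 - 1%:M.
      rewrite /Q mulmxBr mulmx1 [X in _ - X]mulmxBl mul1mx AP// subrr subr0//.
    rewrite mulmxBl mul1mx /a [iter n.+1 _ _]/=.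
    rewrite -[2 * i]addr0 (subdivision_parity AN)//.
    under [X in _ = X + _]eq_bigr do rewrite mulmxBr.
    rewrite sumrB -mulmx_suml addrA.
    have -> : mask_part A 0 = \sum_(j <- int_range N) A (2 * j).
      by rewrite (mask_partE AN)//; apply: eq_bigr => j _; rewrite addr0.
    rewrite subrK; congr (_ - _).
    by apply: eq_bigr => j _; rewrite addr0.
  rewrite (le_trans (ler_normD _ _))// mulrDl lerD//; last first.
    rewrite normrZ gtr0_norm ?invr_gt0// mulrC ler_pM2r ?invr_gt0//.
    by rewrite (le_trans (h3 _))// ler_wpM2l// bK.
  rewrite (le_trans (ler_norm_sum _ _ _))// -mulrA mulr_suml.
  rewrite big_seq [leRHS]big_seq ler_sum// => j; rewrite mem_int_range => jN.
  have [f0 fA] := fP (2 * j); rewrite (le_trans (fA _))// ler_wpM2l//.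
  have aE k : `|a n (k + 1) - a n k| <= G / 2 ^+ n.
    by rewrite ag normrZ gtr0_norm ?invr_gt0// mulrC ler_pM2r ?invr_gt0.
  rewrite (le_trans (lipschitz_int aE _ _))// -mulrA ler_wpM2r//.
    by rewrite divr_ge0// ltW.
  by rewrite -[N%:R]/(N%:Z%:~R) ler_int; lia.
have [Phi aPhi] := choice (floor_sequence_cvg aC ag gK).
have dPhi : forall x : R, is_derive x 1 Phi (Psi x).
  by move=> x; have [cPsi _] := limPsi; exact: (primitive_is_derive ag aPhi gPsi cPsi).
exists Phi, Psi; split=> //; apply/vss_limitP; split.
  move=> x; apply: differentiable_continuous; apply/derivable1_diffP.
  by have [] := dPhi x.
move=> e e0.
have [n0 h0] := dyadic_small (2 * (F * (N%:R * G) + C3 * K + G)) e0.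
exists n0 => n /h0 {}h0 i; apply: le_trans h0.
by have := aPhi (i%:~R / 2 ^+ n) n; rewrite floor_dyadic.
Qed.

End Smoothing.

(** Every limit of [A] has a limit of [B] as its derivative, which brings the extra
    order of smoothness.  For the existence of a nonzero limit, constant data with
    value a nonzero value of a limit of [B] are left unchanged by [A]. *)
Theorem smoothing_vss_C (R : realType) p l (A B : int -> 'M[R]_p) (P : 'M[R]_p) :
  is_mask A -> is_mask B -> P *m P = P ->
  (forall i, P *m (A (i + 1) - A i) + (1%:M - P) *m A i =
    2^-1 *: ((B (i + 2) - B i) *m P + B i *m (1%:M - P))) ->
  mask_even A *m P = P -> mask_odd A *m P = P ->
  (forall v : 'cV_p, mask_even B *m v = v -> mask_odd B *m v = v -> P *m v = v) ->
  vss_C l B -> vss_C l.+1 A.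
Proof.
move=> /is_maskP[NA AN] /is_maskP[NB BN] PP AB AP0 AP1 BP.
move=> [[Bconv [c0 [Psi0 [_ lim0 [x0 Px0]]]]] BC].
pose N := maxn NA NB.
have {}AN : mask_within A N by move=> i iN; apply: AN; lia.
have {}BN : mask_within B N by move=> i iN; apply: BN; lia.
have AP e : 0 <= e <= 1 -> mask_part A e *m P = P.
  move=> e01; have [->|->] : e = 0 \/ e = 1 by lia.
    by rewrite mask_part0.
  by rewrite mask_part1.
have lim := smoothing_limit AN BN PP AB AP BP Bconv.
split; first split.
- by move=> c /lim[Phi [Psi [limPhi _ _]]]; exists Phi.
- pose w := Psi0 x0.
  have Pw : P *m w = w.
    by apply: BP; rewrite -?mask_part0 -?mask_part1 (vss_limit_mask_part BN _ lim0).
  have Sw : subdivision A (fun=> w) = fun=> w.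
    have par i e : 0 <= e <= 1 -> subdivision A (fun=> w) (2 * i + e) = w.
      move=> e01; rewrite (subdivision_parity AN)// -mulmx_suml -(mask_partE AN)//.
      by rewrite -Pw mulmxA AP.
    apply/funext => i; rewrite -[i in LHS](_ : 2 * (i %/ 2)%Z + (i %% 2)%Z = i); last by lia.
    by apply: par; lia.
  exists (fun=> w), (fun=> w); split; last by exists 0.
    by exists `|w|.
  apply/vss_limitP; split=> [x|e e0]; first exact: cvg_cst.
  exists 0%N => n _ i; have -> : iter n (subdivision A) (fun=> w) = fun=> w.
    by elim: n => //= n ->.
  by rewrite subrr normr0 ltW.
move=> c Phi' bc lim'; have [Phi [Psi [limPhi limPsi dPhi]]] := lim _ bc.
have -> : Phi' = Phi by apply: vss_limit_unique lim' limPhi.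
have [dPsi cPsi] := BC _ _ (partial_difference_bounded P bc) limPsi.
have D1 : derive1 Phi = Psi.
  by apply/funext => x; rewrite derive1E; have [_ ->] := dPhi x.
split=> [[|j] x jl|]; last by rewrite derive1Sn D1.
  by have [] := dPhi x.
by rewrite derive1Sn D1; exact: dPsi.
Qed.

(** * Sums over parity classes and symbols *)

Section Masks.
Variables (R : realType) (p : nat).
Implicit Types (A B : int -> 'M[R]_p) (X Y : 'M[R]_p).

Lemma mask_part_range A N e M : mask_within A N -> (N + `|e| <= M)%N ->
  mask_part A e = \sum_(j <- int_range M) A (2 * j + e).
Proof. by move=> AN NM; apply: fsum_int_range => j jM; apply: AN; lia. Qed.

Lemma mask_part_shift A t e : mask_part (fun i => A (i + t)) e = mask_part A (e + t).
Proof. by apply: eq_fsbigr => j _; rewrite addrA. Qed.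

Lemma mask_part_period A e : mask_part A (e + 2) = mask_part A e.
Proof.
rewrite [RHS]/mask_part (@reindex_fsbigT _ _ _ int int (fun j : int => j + 1)); last first.
  by exists (fun j : int => j - 1) => j; lia.
by apply: eq_fsbigr => j _; congr A; lia.
Qed.

Lemma mask_part_mul A N e X Y : mask_within A N ->
  mask_part (fun i => X *m A i *m Y) e = X *m mask_part A e *m Y.
Proof.
move=> AN; have AN' : mask_within (fun i => X *m A i *m Y) N.
  by move=> i /AN ->; rewrite mulmx0 mul0mx.
rewrite (mask_part_range AN (leqnn _)) (mask_part_range AN' (leqnn _)).
by rewrite mulmx_sumr mulmx_suml.
Qed.

Lemma mask_partD A B N e : mask_within A N -> mask_within B N ->
  mask_part (fun i => A i + B i) e = mask_part A e + mask_part B e.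
Proof.
move=> AN BN; have ABN : mask_within (fun i => A i + B i) N.
  by move=> i iN; rewrite AN// BN// addr0.
by rewrite !(@mask_part_range _ N _ _ _ (leqnn _))// big_split.
Qed.

Lemma mask_partB A B N e : mask_within A N -> mask_within B N ->
  mask_part (fun i => A i - B i) e = mask_part A e - mask_part B e.
Proof.
move=> AN BN; have ABN : mask_within (fun i => A i - B i) N.
  by move=> i iN; rewrite AN// BN// subr0.
by rewrite !(@mask_part_range _ N _ _ _ (leqnn _))// sumrB.
Qed.

(** The even and the odd integers of a range, listed separately. *)
Lemma mask_total A N : mask_within A N ->
  \sum_(j <- int_range N) A j = mask_even A + mask_odd A.
Proof.
move=> AN; rewrite -(fsum_int_range AN) -mask_part0 -mask_part1 !(mask_partE AN)//.
pose half e := [seq 2 * j + e | j <- int_range N].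
have mem_half e i : i \in half e -> exists2 j, (`|j| <= N)%N & i = 2 * j + e.
  by case/mapP => j; rewrite mem_int_range => jN ->; exists j.
have uniq_half e : uniq (half e).
  by rewrite map_inj_uniq ?uniq_int_range// => a b /=; lia.
rewrite (@fsbigE _ _ _ _ _ (half 0 ++ half 1))//.
- by under eq_bigl do rewrite in_setT; rewrite big_cat !big_map.
- rewrite cat_uniq !uniq_half andbT/=; apply/hasPn => i /mem_half[j _ ->].
  by apply/negP => /mem_half[j' _]; lia.
move=> i _; rewrite mem_cat negb_or => /andP[i0 i1].
apply: AN; rewrite ltnNge; apply/negP => iN.
have [iE|iE] : i = 2 * (i %/ 2)%Z + 0 \/ i = 2 * (i %/ 2)%Z + 1 by lia.
  by move/negP: i0; apply; apply/mapP; exists (i %/ 2)%Z; rewrite ?mem_int_range; lia.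
by move/negP: i1; apply; apply/mapP; exists (i %/ 2)%Z; rewrite ?mem_int_range; lia.
Qed.

Lemma symbolE A N z : mask_within A N ->
  symbol A z = \sum_(i <- int_range N) z ^ i *: map_mx (real_complex R) (A i).
Proof.
by move=> AN; apply: fsum_int_range => i /AN ->; rewrite map_mx0 scaler0.
Qed.

Lemma symbol1 A N : mask_within A N ->
  symbol A 1 = map_mx (real_complex R) (mask_even A + mask_odd A).
Proof.
move=> AN; rewrite (symbolE _ AN) -(mask_total AN) raddf_sum /=.
by apply: eq_bigr => i _; rewrite exp1rz scale1r.
Qed.

Lemma symbolD A B N z : mask_within A N -> mask_within B N ->
  symbol (fun i => A i + B i) z = symbol A z + symbol B z.
Proof.
move=> AN BN; have ABN : mask_within (fun i => A i + B i) N.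
  by move=> i iN; rewrite AN// BN// addr0.
rewrite !(@symbolE _ N)// -big_split; apply: eq_bigr => i _.
by rewrite map_mxD scalerDr.
Qed.

Lemma symbolB A B N z : mask_within A N -> mask_within B N ->
  symbol (fun i => A i - B i) z = symbol A z - symbol B z.
Proof.
move=> AN BN; have ABN : mask_within (fun i => A i - B i) N.
  by move=> i iN; rewrite AN// BN// subr0.
rewrite !(@symbolE _ N)// -sumrB; apply: eq_bigr => i _.
by rewrite map_mxB scalerBr.
Qed.

Lemma symbol_mul A N z X Y : mask_within A N ->
  symbol (fun i => X *m A i *m Y) z =
  map_mx (real_complex R) X *m symbol A z *m map_mx (real_complex R) Y.
Proof.
move=> AN; have AN' : mask_within (fun i => X *m A i *m Y) N.
  by move=> i /AN ->; rewrite mulmx0 mul0mx.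
rewrite !(@symbolE _ N)// mulmx_sumr mulmx_suml; apply: eq_bigr => i _.
by rewrite !map_mxM -scalemxAr -scalemxAl.
Qed.

Lemma symbol_shift A N t z : mask_within A N -> z != 0 ->
  symbol (fun i => A (i + t)) z = z ^ (- t) *: symbol A z.
Proof.
move=> AN z0; have -> : z ^ (- t) *: symbol A z =
    \sum_(i \in [set: int]) z ^ (i - t) *: map_mx (real_complex R) (A i).
  rewrite (symbolE _ AN) scaler_sumr (@fsum_int_range _ _ N) => [|i /AN ->].
    by apply: eq_bigr => i _; rewrite scalerA -expfzDr// addrC.
  by rewrite map_mx0 scaler0.
rewrite [RHS](@reindex_fsbigT _ _ _ int int (fun j : int => j + t)); last first.
  by exists (fun j : int => j - t) => j; lia.
by apply: eq_fsbigr => j _; rewrite addrK.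
Qed.

End Masks.

(** * The smoothed mask *)

(** After multiplication by [z^N] an entry of the symbol is a polynomial of degree
    at most [2N] that vanishes at the [2N + 1] points 2, ..., 2N + 2. *)
Lemma symbol_eq0 (R : realType) p (A : int -> 'M[R]_p) N : mask_within A N ->
  (forall z : R[i], z != 0 -> z != 1 -> symbol A z = 0) -> forall i, A i = 0.
Proof.
move=> AN A0 i; have [iN|iN] := leqP `|i|%N N; last exact: AN.
apply/matrixP => r s; rewrite mxE.
pose q : {poly R[i]} := \poly_(t < N + N + 1) real_complex R (A (t%:Z - N%:Z) r s).
have qz z : z != 0 -> z != 1 -> root q z.
  move=> z0 z1; rewrite /root horner_poly.
  have H := congr1 (fun M : 'M[R[i]]_p => z ^ N%:Z * M r s) (A0 z z0 z1).
  rewrite /= mxE mulr0 (symbolE _ AN) summxE mulr_sumr big_map in H.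
  apply/eqP; rewrite -[RHS]H.
  have -> : iota 0 (N + N + 1) = index_iota 0 (N + N + 1) by rewrite /index_iota subn0.
  rewrite big_mkord.
  apply: eq_bigr => t _; rewrite !mxE mulrA -expfzDr//.
  have -> : N%:Z + (t%:Z - N%:Z) = t%:Z :> int by lia.
  by rewrite mulrC.
have q0 : q = 0.
  apply/eqP/negP => /negP qn0.
  pose zs := [seq (t.+2)%:R : R[i] | t <- iota 0 (N + N + 1)].
  have /(max_poly_roots qn0) : all (root q) zs.
    apply/allP => z /mapP[t _ ->]; apply: qz; first by rewrite pnatr_eq0.
    by rewrite -[1]/(1%:R) eqr_nat.
  have zsu : uniq zs.
    by rewrite map_inj_uniq ?iota_uniq// => a b /eqP; rewrite eqr_nat => /eqP[].
  move=> /(_ zsu); rewrite size_map size_iota ltnNge => /negP; apply.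
  exact: size_poly.
have := congr1 (fun P : {poly _} => P`_(absz (i + N%:Z))) q0.
rewrite coef0 coef_poly; case: ifP => [_|]; last by lia.
have -> : (absz (i + N%:Z))%:Z - N%:Z = i by lia.
by move/eqP; rewrite fmorph_eq0 => /eqP.
Qed.

Lemma symbol_inj (R : realType) p (A B : int -> 'M[R]_p) :
  is_mask A -> is_mask B ->
  (forall z : R[i], z != 0 -> z != 1 -> symbol A z = symbol B z) -> A = B.
Proof.
move=> /is_maskP[N AN] /is_maskP[N' BN] AB; apply/funext => i; apply/eqP.
pose M := maxn N N'.
have {}AN : mask_within A M by move=> j jM; apply: AN; lia.
have {}BN : mask_within B M by move=> j jM; apply: BN; lia.
rewrite -subr_eq0; apply/eqP; move: i; apply: (@symbol_eq0 _ _ _ M).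
  by move=> j jM; rewrite AN// BN// subr0.
by move=> z z0 z1; rewrite (symbolB _ AN BN) AB// subrr.
Qed.

Lemma ursubmx_sum (R : nmodType) (m1 m2 n1 n2 : nat) (I : Type) (s : seq I)
    (F : I -> 'M[R]_(m1 + m2, n1 + n2)) :
  ursubmx (\sum_(i <- s) F i) = \sum_(i <- s) ursubmx (F i).
Proof.
apply/matrixP => r c; rewrite !mxE !summxE.
by apply: eq_bigr => i _; rewrite !mxE.
Qed.

Section SmoothingMask.
Variables (R : realType) (k m N : nat) (B : int -> 'M[R]_(k + m)).
Hypothesis BN : mask_within B N.

Definition block_proj : 'M[R]_(k + m) := block_mx 1%:M 0 0 0.

(** The coefficients of the smoothed symbol: multiplication by [z^-1] shifts
    indices by one, and division by [z^-1 - 1] takes partial sums. *)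
Definition smoothing_mask : int -> 'M[R]_(k + m) := fun i =>
  2^-1 *: block_mx (ulsubmx (B i) + ulsubmx (B (i + 1)))
                   (\sum_(j <- int_range N | j < i) ursubmx (B j))
                   (dlsubmx (B (i + 2)) - dlsubmx (B i)) (drsubmx (B i)).

Lemma block_proj_idem : block_proj *m block_proj = block_proj.
Proof.
by rewrite /block_proj mulmx_block !mulmx0 !mul0mx !addr0 mulmx1.
Qed.

Lemma block_proj_compl : 1%:M - block_proj = block_mx 0 0 0 1%:M.
Proof.
by rewrite (scalar_mx_block k m) /block_proj opp_block_mx add_block_mx !subr0 subrr.
Qed.

Lemma ursubmx_partial_sum i :
  \sum_(j <- int_range N | j < i + 1) ursubmx (B j) =
  \sum_(j <- int_range N | j < i) ursubmx (B j) + ursubmx (B i).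
Proof.
rewrite (bigID (fun j => j < i)) /=; congr (_ + _).
  by apply: eq_bigl => j; lia.
rewrite (eq_bigl (fun j => j == i)) => [|j]; last by lia.
have [iN|iN] := leqP `|i|%N N.
  rewrite -big_filter (_ : [seq j <- _ | _] = [:: i]) ?big_seq1//.
  by rewrite filter_pred1_uniq ?uniq_int_range// mem_int_range.
have -> : ursubmx (B i) = 0 by rewrite BN//; apply/matrixP => r s; rewrite !mxE.
rewrite big_seq_cond big1// => j /andP[jN /eqP ji].
by move: jN; rewrite ji mem_int_range leqNgt iN.
Qed.

(** Blockwise: differences of [B i + B (i + 1)] telescope to [B (i + 2) - B i],
    and differences of partial sums give back the summand. *)
Lemma smoothing_mask_difference i :
  block_proj *m (smoothing_mask (i + 1) - smoothing_mask i) +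
    (1%:M - block_proj) *m smoothing_mask i =
  2^-1 *: ((B (i + 2) - B i) *m block_proj + B i *m (1%:M - block_proj)).
Proof.
rewrite block_proj_compl /smoothing_mask -scalerBr -!scalemxAr -scalerDr.
congr (_ *: _); rewrite ursubmx_partial_sum.
have -> : i + 1 + 1 = i + 2 by lia.
have mulBP (X : 'M[R]_(k + m)) :
    X *m block_proj = block_mx (ulsubmx X) 0 (dlsubmx X) 0 :> 'M[R]_(k + m).
  by rewrite -{1}[X]submxK mulmx_block !mulmx1 !mulmx0 !addr0.
have mulBQ (X : 'M[R]_(k + m)) :
    X *m block_mx 0 0 0 1%:M = block_mx 0 (ursubmx X) 0 (drsubmx X) :> 'M[R]_(k + m).
  by rewrite -{1}[X]submxK mulmx_block !mulmx1 !mulmx0 !add0r.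
rewrite mulmxBl !mulBP !mulBQ /block_proj !opp_block_mx !add_block_mx !mulmx_block.
rewrite !mul1mx !mul0mx !oppr0 !addr0 !add0r add_block_mx !addr0 !add0r.
by congr block_mx; apply/matrixP => r s; rewrite !mxE; ring.
Qed.

Hypothesis B0 : ursubmx (mask_even B + mask_odd B) = 0.

(** To the right of the support of [B] the partial sums of the (1,2) blocks are the
    total sum, which vanishes by hypothesis. *)
Lemma smoothing_mask_within : mask_within smoothing_mask (N + 2).
Proof.
move=> i iN; rewrite /smoothing_mask !BN//; try by lia.
have -> : \sum_(j <- int_range N | j < i) ursubmx (B j) = 0.
  have [iN'|iN'] := ltP i (- N%:Z).
    rewrite big_seq_cond big1// => j /andP[jN ji].
    by move: jN; rewrite mem_int_range; lia.
  rewrite -[RHS]B0 -(mask_total BN) ursubmx_sum [RHS]big_seq [LHS]big_seq_cond.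
  apply: eq_bigl => j; apply: andb_idr; rewrite mem_int_range => jN; lia.
rewrite -[RHS](scaler0 _ 2^-1) -[X in _ = _ *: X]block_mx0.
by congr (_ *: block_mx _ _ _ _); apply/matrixP => r s; rewrite !mxE ?addr0 ?subr0.
Qed.

Lemma smoothing_mask_is_mask : is_mask smoothing_mask.
Proof. by apply/is_maskP; exists (N + 2)%N; exact: smoothing_mask_within. Qed.

(** The relation of [smoothing_mask_difference], summed against [z^i], determines
    the four blocks of the symbol since [z^-1 - 1] is invertible. *)
Lemma is_smoothing_smoothing_mask : is_smoothing B smoothing_mask.
Proof.
split; first exact: smoothing_mask_is_mask.
move=> z z0 z1.
pose cm (X : 'M[R]_(k + m)) := map_mx (real_complex R) X.
pose Y := smoothing_mask.
pose M := (N + 4)%N.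
have Yw : mask_within Y M by move=> i iM; apply: smoothing_mask_within; rewrite /M in iM; lia.
have Y1w : mask_within (fun i => Y (i + 1)) M.
  by move=> i iM; apply: smoothing_mask_within; rewrite /M in iM; lia.
have Bw : mask_within B M by move=> i iM; apply: BN; rewrite /M in iM; lia.
have B2w : mask_within (fun i => B (i + 2)) M.
  by move=> i iM; apply: BN; rewrite /M in iM; lia.
have YDw : mask_within (fun i => Y (i + 1) - Y i) M.
  by move=> i iM; rewrite (Y1w i iM) Yw// subr0.
have BDw : mask_within (fun i => B (i + 2) - B i) M.
  by move=> i iM; rewrite (B2w i iM) Bw// subr0.
have W1 (F : int -> 'M[R]_(k + m)) (X Z : 'M[R]_(k + m)) :
    mask_within F M -> mask_within (fun i => X *m F i *m Z) M.
  by move=> Fw i iM; rewrite Fw// mulmx0 mul0mx.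
have sL : symbol (fun i => block_proj *m (Y (i + 1) - Y i) *m 1%:M +
      (1%:M - block_proj) *m Y i *m 1%:M) z =
    cm block_proj *m ((z^-1 - 1) *: symbol Y z) + cm (1%:M - block_proj) *m symbol Y z.
  rewrite (@symbolD _ _ _ _ M) ?(@symbol_mul _ _ _ M)//; try exact: W1.
  rewrite (symbolB _ Y1w Yw) (symbol_shift _ Yw z0) map_mx1 !mulmx1.
  by rewrite scalerBl scale1r.
have sR : symbol (fun i => (2^-1)%:M *m (B (i + 2) - B i) *m block_proj +
      (2^-1)%:M *m B i *m (1%:M - block_proj)) z =
    2^-1 *: (((z ^- 2 - 1) *: symbol B z) *m cm block_proj +
      symbol B z *m cm (1%:M - block_proj)).
  rewrite (@symbolD _ _ _ _ M) ?(@symbol_mul _ _ _ M)//; try exact: W1.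
  rewrite (symbolB _ B2w Bw) (symbol_shift _ Bw z0) map_scalar_mx !mul_scalar_mx.
  rewrite scalerBl scale1r [RHS]scalerDr -!scalemxAl fmorphV rmorph_nat.
  by rewrite scalemxAl.
have {sL sR} key : cm block_proj *m ((z^-1 - 1) *: symbol Y z) +
     cm (1%:M - block_proj) *m symbol Y z =
    2^-1 *: (((z ^- 2 - 1) *: symbol B z) *m cm block_proj +
      symbol B z *m cm (1%:M - block_proj)).
  rewrite -sL -sR; apply: eq_fsbigr => i _; congr (_ *: map_mx _ _).
  rewrite !mulmx1 smoothing_mask_difference !mul_scalar_mx scalerDr.
  by rewrite -!scalemxAl.
move: key; rewrite block_proj_compl /cm !map_block_mx !map_mx0 !map_mx1.
(* Only the first block row carries the factor [z^-1 - 1]; in the (1,1) block it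
   cancels in [z^-2 - 1 = (z^-1 - 1) (z^-1 + 1)]. *)
have z11 : z^-1 - 1 != 0.
  by rewrite subr_eq0 -[X in _ != X]invr1 (inj_eq invr_inj).
rewrite -/Y; move: (symbol Y z) (symbol B z) => y b.
rewrite -{1 2}[y]submxK -{1 2}[b]submxK !scale_block_mx !mulmx_block.
rewrite !mul1mx !mul0mx !mulmx1 !mulmx0 !addr0 !add0r !add_block_mx !addr0 !add0r.
rewrite scale_block_mx => /eq_block_mx[e1 e2 e3 e4].
rewrite -[LHS]submxK; congr block_mx.
- apply: (scalerI z11); rewrite e1 !scalerA; congr (_ *: _).
  by field; rewrite z0.
- by apply: (scalerI z11); rewrite e2 !scalerA mulrCA divff// mulr1.
- by rewrite e3.
by rewrite e4.
Qed.

Lemma is_smoothing_unique Y : is_smoothing B Y -> smoothing_mask = Y.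
Proof.
move=> [Ym YB]; have [Sm SB] := is_smoothing_smoothing_mask.
by apply: symbol_inj => // z z0 z1; rewrite SB// YB.
Qed.

Lemma smoothing_mask_block_proj i :
  smoothing_mask i *m block_proj =
  (2^-1 *: block_proj) *m (B i + B (i + 1)) *m block_proj +
  (2^-1 *: (1%:M - block_proj)) *m (B (i + 2) - B i) *m block_proj.
Proof.
rewrite block_proj_compl -!mulmxA -!scalemxAl -scalerDr mulmxDl mulmxBl; congr (_ *: _).
have mulP (X : 'M[R]_(k + m)) :
    X *m block_proj = block_mx (ulsubmx X) 0 (dlsubmx X) 0 :> 'M[R]_(k + m).
  by rewrite -{1}[X]submxK mulmx_block !mulmx1 !mulmx0 !addr0.
rewrite !mulP opp_block_mx !add_block_mx /block_proj !mulmx_block.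
by rewrite !(mul1mx, mul0mx, oppr0, addr0, add0r, add_block_mx, block_mxKul, block_mxKdl).
Qed.

(** The differences [B (i + 2) - B i] sum to zero on each parity class, and
    [B i + B (i + 1)] meets both classes once, each contributing a copy of the
    projection, which the factor 1/2 averages. *)
Lemma smoothing_mask_part e : 0 <= e <= 1 ->
  (forall e, 0 <= e <= 1 -> mask_part B e *m block_proj = block_proj) ->
  mask_part smoothing_mask e *m block_proj = block_proj.
Proof.
move=> e01 BP; pose M := (N + 4)%N.
have Yw : mask_within smoothing_mask M.
  by move=> i iM; apply: smoothing_mask_within; rewrite /M in iM; lia.
have Bw : mask_within B M by move=> i iM; apply: BN; rewrite /M in iM; lia.
have B1w : mask_within (fun i => B (i + 1)) M.
  by move=> i iM; apply: BN; rewrite /M in iM; lia.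
have B2w : mask_within (fun i => B (i + 2)) M.
  by move=> i iM; apply: BN; rewrite /M in iM; lia.
have Sw : mask_within (fun i => B i + B (i + 1)) M.
  by move=> i iM; rewrite (B1w i iM) Bw// addr0.
have Dw : mask_within (fun i => B (i + 2) - B i) M.
  by move=> i iM; rewrite (B2w i iM) Bw// subr0.
have mw (F : int -> 'M[R]_(k + m)) (X Z : 'M[R]_(k + m)) :
    mask_within F M -> mask_within (fun i => X *m F i *m Z) M.
  by move=> Fw i iM; rewrite Fw// mulmx0 mul0mx.
rewrite -[mask_part _ e]mul1mx -(mask_part_mul _ _ _ Yw).
have -> : (fun i => 1%:M *m smoothing_mask i *m block_proj) = fun i =>
    (2^-1 *: block_proj) *m (B i + B (i + 1)) *m block_proj +
    (2^-1 *: (1%:M - block_proj)) *m (B (i + 2) - B i) *m block_proj.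
  by apply/funext => i; rewrite mul1mx smoothing_mask_block_proj.
rewrite (@mask_partD _ _ _ _ M) ?(@mask_part_mul _ _ _ M)//; try exact: mw.
rewrite (mask_partD _ Bw B1w) (mask_partB _ B2w Bw) !mask_part_shift mask_part_period.
have Be1 : mask_part B (e + 1) *m block_proj = block_proj.
  have [->|->] : e = 0 \/ e = 1 by lia.
    exact: BP.
  by rewrite (_ : 1 + 1 = 0 + 2) ?mask_part_period ?BP.
rewrite subrr mulmx0 mul0mx addr0 -mulmxA mulmxDl BP// Be1 mulmxDr -!scalemxAl.
by rewrite block_proj_idem -scalerDl -[X in X + _]mul1r -[X in _ + X]mul1r -splitr scale1r.
Qed.

End SmoothingMask.

(** * Canonical transformations *)

Lemma mulmx_col (R : pzSemiRingType) m n p (X : 'M[R]_(m, n)) (W : 'M[R]_(n, p)) j :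
  col j (X *m W) = X *m col j W.
Proof. by rewrite !colE mulmxA. Qed.

Lemma span_cols_mulmx0 (R : realType) p n (X : 'M[R]_p) (W : 'M[R]_(p, n)) v :
  X *m W = 0 -> v \in <<[seq col j W | j : 'I_n]>>%VS -> X *m v = 0.
Proof.
move=> XW; suff /subvP sub : (<<[seq col j W | j : 'I_n]>> <= lker (linfun (mulmx X)))%VS.
  by move=> /sub; rewrite memv_ker lfunE => /eqP.
apply/span_subvP => _ /mapP[j _ ->].
by rewrite memv_ker lfunE /= -mulmx_col XW; apply/eqP/matrixP => r s; rewrite !mxE.
Qed.

(** Generalized eigenspaces are stable under the matrix, and so are their sums. *)
Lemma invariant_space_neq1_stable (R : realType) p (M : 'M[R]_p) v :
  invariant_space_neq1 M v -> invariant_space_neq1 M (M *m v).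
Proof.
rewrite /invariant_space_neq1 /=; set MC := map_mx _ _; set S := (\big[_/_]_(a \in _) _)%MS.
move=> vS; rewrite trmx_mul map_mxM -/MC (submx_trans (submxMr _ vS))//.
rewrite /S.
elim/big_ind : _ => [|U V US VS|a _]; first by rewrite mul0mx.
  by rewrite addsmxMr (submx_trans (addsmxS US VS)).
exact: comm_mx_stable_geigenspace.
Qed.

Section Canonical.
Variables (R : realType) (k m : nat) (B : int -> 'M[R]_(k + m)) (T : 'M[R]_(k + m)).
Variable N : nat.
Hypotheses (BN : mask_within B N) (TB : canonical_transformation B T).

(** The projection onto the eigenspace of the mask along the invariant space for
    the eigenvalues of the mean different from 1. *)
Definition canonical_proj : 'M[R]_(k + m) := T *m block_proj R k m *m invmx T.

Let Tu : T \in unitmx. Proof. by case: TB. Qed.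

Lemma canonical_block_proj : T *m block_proj R k m = row_mx (lsubmx T) 0.
Proof.
by rewrite -{1}[T]hsubmxK mul_row_block mulmx1 !mulmx0 !addr0.
Qed.

Lemma canonical_proj_cols :
  canonical_proj *m lsubmx T = lsubmx T /\ canonical_proj *m rsubmx T = 0.
Proof.
apply: eq_row_mx; rewrite -mul_mx_row hsubmxK -canonical_block_proj.
by rewrite /canonical_proj mulmxKV.
Qed.

Lemma mask_part_canonical e : 0 <= e <= 1 -> mask_part B e *m lsubmx T = lsubmx T.
Proof.
move=> e01; have [_ bT _] := TB.
apply/matrixP => r s; have /(basis_mem bT) : col s (lsubmx T) \in [seq col j (lsubmx T) | j : 'I_k].
  by apply/mapP; exists s; rewrite ?mem_enum.
move=> /mask_eigenspaceP[Be Bo].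
have : mask_part B e *m col s (lsubmx T) = col s (lsubmx T).
  have [->|->] : e = 0 \/ e = 1 by lia.
    by rewrite mask_part0.
  by rewrite mask_part1.
rewrite -mulmx_col => /matrixP/(_ r 0).
by rewrite !mxE.
Qed.

Lemma eigenspace_canonical_proj v :
  v \in mask_eigenspace B -> canonical_proj *m v = v.
Proof.
have [_ bT _] := TB; rewrite -(span_basis bT) => /(@span_cols_mulmx0 _ _ _ (canonical_proj - 1%:M)).
rewrite !mulmxBl canonical_proj_cols.1 mul1mx subrr mul1mx => /(_ erefl)/eqP.
by rewrite subr_eq0 => /eqP.
Qed.

Lemma canonical_proj_mean : canonical_proj *m mask_mean B *m rsubmx T = 0.
Proof.
have [_ _ iT] := TB.
apply/matrixP => r s; pose w := col s (rsubmx T).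
have : invariant_space_neq1 (mask_mean B) (mask_mean B *m w).
  apply: invariant_space_neq1_stable; rewrite -iT /=; apply: memv_span.
  by apply/mapP; exists s; rewrite ?mem_enum.
rewrite -iT /= => /(span_cols_mulmx0 canonical_proj_cols.2).
rewrite !mulmxA -mulmx_col => /matrixP/(_ r 0).
by rewrite !mxE.
Qed.

End Canonical.

Lemma block_proj_mulmx_eq0 (R : realType) k m n (Z : 'M[R]_(k + m, n)) :
  block_proj R k m *m Z = 0 -> usubmx Z = 0.
Proof.
rewrite -{1}[Z]vsubmxK mul_block_col mul1mx !mul0mx !addr0 -col_mx0.
by case/eq_col_mx.
Qed.

Section Conjugation.
Variables (R : realType) (p : nat) (T : 'M[R]_p).
Hypothesis Tu : T \in unitmx.

Definition basis_change (X : 'M[R]_p) : 'M[R]_p := T *m X *m invmx T.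

Lemma basis_changeM X Y : basis_change X *m basis_change Y = basis_change (X *m Y).
Proof. by rewrite /basis_change !mulmxA mulmxKV. Qed.

Lemma basis_changeD X Y : basis_change (X + Y) = basis_change X + basis_change Y.
Proof. by rewrite /basis_change mulmxDr mulmxDl. Qed.

Lemma basis_changeB X Y : basis_change (X - Y) = basis_change X - basis_change Y.
Proof. by rewrite /basis_change mulmxBr mulmxBl. Qed.

Lemma basis_changeZ a X : basis_change (a *: X) = a *: basis_change X.
Proof. by rewrite /basis_change -scalemxAr -scalemxAl. Qed.

Lemma basis_change1 : basis_change 1%:M = 1%:M.
Proof. by rewrite /basis_change mulmx1 mulmxV. Qed.

End Conjugation.

Theorem mainTheorem1 (R : realType) (k m l : nat)
    (B : int -> 'M[R]_(k + m)) (T : 'M[R]_(k + m)) :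
  is_mask B ->
  vss_C l B ->
  k = \dim (mask_eigenspace B) ->
  canonical_transformation B T ->
  let Bbar := fun i : int => invmx T *m B i *m T in
  ursubmx (symbol Bbar 1) = 0 /\
  exists Abar : int -> 'M[R]_(k + m),
    unique (is_smoothing Bbar) Abar /\
    let A := fun i : int => T *m Abar i *m invmx T in
    is_mask A /\ vss_C l.+1 A.
Proof.
move=> Bm BC _ TB Bbar; have [Tu _ _] := TB.
have [N BN] := (is_maskP B).1 Bm.
have BbarN : mask_within Bbar N by move=> i iN; rewrite /Bbar BN// mulmx0 mul0mx.
have Bbar_part e : mask_part Bbar e = invmx T *m mask_part B e *m T.
  exact: mask_part_mul BN.
have BbarP e : 0 <= e <= 1 -> mask_part Bbar e *m block_proj R k m = block_proj R k m.
  move=> e01; rewrite Bbar_part -!mulmxA canonical_block_proj mul_mx_row mulmx0.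
  by rewrite (mask_part_canonical TB)// -canonical_block_proj mulKmx.
have Bbar0 : ursubmx (mask_even Bbar + mask_odd Bbar) = 0.
  have -> : mask_even Bbar + mask_odd Bbar = 2 *: (invmx T *m mask_mean B) *m T.
    rewrite -mask_part0 -mask_part1 !Bbar_part -mulmxDl -mulmxDr mask_part0 mask_part1.
    by rewrite /mask_mean -scalemxAr scalerA divff ?pnatr_eq0// scale1r.
  have -> X : ursubmx X = usubmx (rsubmx X) :> 'M[R]_(k, m).
    by apply/matrixP => r s; rewrite !mxE.
  rewrite -[T in _ *m T]hsubmxK mul_mx_row row_mxKr.
  apply: block_proj_mulmx_eq0; rewrite -scalemxAl -scalemxAr.
  suff -> : block_proj R k m *m (invmx T *m mask_mean B *m rsubmx T) = 0 by rewrite scaler0.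
  apply: (can_inj (mulKmx Tu)); rewrite mulmx0 !mulmxA.
  exact: canonical_proj_mean TB.
split; first by rewrite (symbol1 BbarN) -map_ursubmx Bbar0 map_mx0.
pose Abar := smoothing_mask N Bbar.
exists Abar; split.
  split; first exact: is_smoothing_smoothing_mask.
  by move=> Y; exact: is_smoothing_unique.
move=> A.
have AbarN : mask_within Abar (N + 2) by exact: smoothing_mask_within.
have Am : is_mask A.
  by apply/is_maskP; exists (N + 2)%N => i iN; rewrite /A AbarN// mulmx0 mul0mx.
have BE i : B i = basis_change T (Bbar i).
  by rewrite /basis_change /Bbar -!mulmxA mulmxV// mulmx1 mulKVmx.
have APe e : 0 <= e <= 1 ->
    mask_part A e *m basis_change T (block_proj R k m) = basis_change T (block_proj R k m).
  move=> e01; rewrite (mask_part_mul _ _ _ AbarN) (basis_changeM Tu).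
  by rewrite (smoothing_mask_part BbarN).
split=> //; apply: (@smoothing_vss_C _ _ _ _ B (basis_change T (block_proj R k m))) => //.
- by rewrite (basis_changeM Tu) block_proj_idem.
- move=> i; rewrite -(basis_change1 Tu) !BE -!basis_changeB !(basis_changeM Tu).
  rewrite -!basis_changeD -!basis_changeZ; congr basis_change.
  exact: smoothing_mask_difference.
- by rewrite -mask_part0 APe.
- by rewrite -mask_part1 APe.
by move=> v v0 v1; apply: (eigenspace_canonical_proj TB); exact: (mask_eigenspaceP B v).2.
Qed.
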